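(* For every $n\ge 2$ the following three subsets of $\mathbb{TP}^{\binom n1-1}\times\cdots\times\mathbb{TP}^{\binom n{n-1}-1}$ are equal: (1) the totally non-negative tropical complete flag variety $trFl_n^{\ge 0}=\overline{\mathrm{trop}}^{\ge 0}(I_{IP;n})$; (2) the totally non-negative three-term complete flag Dressian $(FlDr_n^{3M})^{\ge 0}$; (3) the totally non-negative complete flag Dressian $FlDr_n^{\ge 0}=\overline{\mathrm{trop}}^{\ge 0}(\mathfrak P_{IP;n})$.
   Context: Let $[n]=\{1,\dots,n\}$. Work in the polynomial ring over $\mathbb{R}$ in variables $P_I$, indexed by subsets $I\subset[n]$ with $1\le |I|\le n-1$. Incidence-Plücker relations: for $1\le r\le s\le n$, $I\subset[n]$ with $|I|=r-1$ and $J\subset[n]$ with $|J|=s+1$, the incidence-Plücker relation is the polynomial $\sum_{j\in J\setminus I}\mathrm{sign}(j,I,J)\,P_{I\cup\{j\}}P_{J\setminus\{j\}}$, where $\mathrm{sign}(j,I,J)=(-1)^{|\{k\in J:\,k<j\}|+|\{i\in I:\,j<i\}|}$. $\mathfrak P_{IP;n}$ denotes the set of all incidence-Plücker relations, and $I_{IP;n}$ the ideal they generate. $\mathfrak P^{3\text{ term}}_{IP;n}$ denotes the set of incidence-Plücker relations with exactly three terms (i.e. $|J\setminus I|=3$). Tropical notions: $\mathbb T=\mathbb R\cup\{\infty\}$. For $m\ge1$, $\mathbb{TP}^{m-1}=(\mathbb T^m\setminus\{(\infty,\dots,\infty)\})/\sim$ where $x\sim y$ iff $x=y+(c,\dots,c)$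 for some $c\in\mathbb R$. Points of $\mathbb{TP}^{\binom n1-1}\times\cdots\times\mathbb{TP}^{\binom n{n-1}-1}$ have coordinates $P_I$, the $k$-th factor having coordinates indexed by the $k$-subsets of $[n]$. For a polynomial $p=\sum_{b} c_b x^{b}$ with real coefficients (written with distinct exponent vectors $b$ and all $c_b\ne 0$) and a point $y$, the value of the term $c_bx^b$ at $y$ is $b\cdot y$ (with $0\cdot\infty=0$; real coefficients contribute nothing). The point $y$ is a solution of the tropicalization of $p$ if the minimum of the term values is attained by at least two terms; it is a positive solution if moreover the minimum is attained by at least one term with $c_b>0$ and at least one term with $c_b<0$. For multihomogeneous $p$ these notions are well defined on the product of tropical projective spaces. For a set (or ideal) $\mathcal P$ of such polynomials, $\overline{\mathrm{trop}}(\mathcal P)$ is the set of points that are solutions of the tropicalizations of all $p\in\mathcal P$, and $\overline{\mathrm{trop}}^{\ge0}(\mathcal P)$ the set of points that are positive solutions of the tropicalizations of all $p\in\mathcal P$. The support of a point $P$ is $\{I: P_I\ne\infty\}$. A (complete) flag matroid on $[n]$ is a sequence $(\mathcal M_1,\dots,\mathcal M_{n-1})$ of matroids on $[n]$ with $\mathrm{rank}\,\mathcal M_i=i$ such that for all $j<k$ every basis of $\mathcal M_j$ is contained in some basis of $\mathcal M_k$ and every basis of $\mathcal M_k$ contains some basis of $\mathcal M_j$; a set of subsets ''forms a flag matroid'' if, for each $k$, its $k$-element members are the bases of $\mathcal M_k$ for such a flag matroid. $(FlDr_n^{3M})^{\ge0}$ is the set of points of $\overline{\mathrm{trop}}^{\ge0}(\mathfrak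 P^{3\text{ term}}_{IP;n})$ whose support forms a flag matroid. *)

(* Defs.v *)
From HB Require Import structures.
From mathcomp Require Import all_boot all_order all_algebra.
From mathcomp Require Import reals.
From mathcomp Require Import mpoly.

Set Implicit Arguments.
Unset Strict Implicit.
Unset Printing Implicit Defensive.

Import Order.TTheory GRing.Theory Num.Theory.
Local Open Scope ring_scope.

Definition validb (n : nat) (I : {set 'I_n}) : bool :=
  (0 < #|I|)%N && (#|I| < n)%N.

Definition Var (n : nat) := {I : {set 'I_n} | validb I}.

Definition nvar (n : nat) : nat := #|{: Var n}|.

Definition Poly (R : realType) (n : nat) := {mpoly R[nvar n]}.

(* The variable P_I (only ever used for valid I; 0 otherwise) *)
Definition Pvar (R : realType) (n : nat) (I : {set 'I_n}) : Poly R n :=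
  match insub I with
  | Some v => 'X_(enum_rank v)
  | None => 0
  end.

Definition IPsign (R : realType) (n : nat) (j : 'I_n) (I J : {set 'I_n}) : R :=
  (-1) ^+ (#|[set k in J | (k < j)%N]| + #|[set i in I | (j < i)%N]|).

Definition IPrel (R : realType) (n : nat) (I J : {set 'I_n}) : Poly R n :=
  \sum_(j in J :\: I) (IPsign R j I J)%:MP * (Pvar R (j |: I) * Pvar R (J :\ j)).

Definition IPadm (n : nat) (I J : {set 'I_n}) : Prop :=
  exists r s : nat, [/\ (1 <= r)%N, (r <= s)%N, (s <= n)%N,
                        #|I| = r.-1 & #|J| = s.+1].

Definition IP_rels (R : realType) (n : nat) (p : Poly R n) : Prop :=
  exists I J : {set 'I_n}, IPadm I J /\ p = IPrel R I J.

Definition IP_rels3 (R : realType) (n : nat) (p : Poly R n) : Prop :=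
  exists I J : {set 'I_n}, [/\ IPadm I J, #|J :\: I| = 3%N & p = IPrel R I J].

Definition ideal_gen (R : realType) (n : nat) (S : Poly R n -> Prop)
  (p : Poly R n) : Prop :=
  exists s : seq (Poly R n * Poly R n),
    (forall x, x \in s -> S x.2) /\ p = \sum_(x <- s) x.1 * x.2.

Definition I_IP (R : realType) (n : nat) : Poly R n -> Prop :=
  ideal_gen (@IP_rels R n).

(* Tropical numbers T = R u {oo}: [None] stands for oo. *)
Definition trop (R : realType) := option R.

Definition tle (R : realType) (a b : trop R) : bool :=
  match a, b with
  | _, None => true
  | None, Some _ => false
  | Some x, Some y => x <= y
  end.

(* a point given by coordinates P_I (a representative) *)
Definition Point (R : realType) (n : nat) := Var n -> trop R.

(* value b . y of the term with exponent vector b (0 * oo = 0) *)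
Definition tval (R : realType) (n : nat) (b : 'X_{1..nvar n}) (y : Point R n)
  : trop R :=
  if [forall i : 'I_(nvar n), (0 < b i)%N ==> (y (enum_val i) != None)]
  then Some (\sum_(i < nvar n) (b i)%:R * odflt 0 (y (enum_val i)))
  else None.

(* y is a positive solution of the tropicalization of p.
   Convention: the zero polynomial (no terms) is satisfied by every point. *)
Definition pos_sol (R : realType) (n : nat) (p : Poly R n) (y : Point R n)
  : Prop :=
  p = 0 \/
  exists b1 b2 : 'X_{1..nvar n},
    [/\ b1 \in msupp p, b2 \in msupp p, 0 < p@_b1 & p@_b2 < 0] /\
    tval b1 y = tval b2 y /\
    (forall b, b \in msupp p -> tle (tval b1 y) (tval b y)).

Definition trop_pos (R : realType) (n : nat) (S : Poly R n -> Prop)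
  (y : Point R n) : Prop :=
  forall p, S p -> pos_sol p y.

(* y represents a point of TP^{C(n,1)-1} x ... x TP^{C(n,n-1)-1}:
   in every factor k some coordinate is finite. *)
Definition in_TP (R : realType) (n : nat) (y : Point R n) : Prop :=
  forall k : nat, (1 <= k <= n.-1)%N ->
    exists I : Var n, #|val I| = k /\ y I != None.

Definition matroid_bases (n : nat) (B : {set {set 'I_n}}) : Prop :=
  B != set0 /\
  forall B1 B2, B1 \in B -> B2 \in B -> forall x, x \in B1 :\: B2 ->
    exists2 z, z \in B2 :\: B1 & (z |: (B1 :\ x)) \in B.

Definition matroid_of_rank (n : nat) (B : {set {set 'I_n}}) (k : nat) : Prop :=
  matroid_bases B /\ forall X, X \in B -> #|X| = k.

Definition flag_matroid (n : nat) (M : nat -> {set {set 'I_n}}) : Prop :=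
  (forall k, (1 <= k <= n.-1)%N -> matroid_of_rank (M k) k) /\
  (forall j k, (1 <= j)%N -> (j < k)%N -> (k <= n.-1)%N ->
     (forall X, X \in M j -> exists2 Y, Y \in M k & X \subset Y) /\
     (forall Y, Y \in M k -> exists2 X, X \in M j & X \subset Y)).

Definition supp (R : realType) (n : nat) (y : Point R n) : {set 'I_n} -> Prop :=
  fun I => exists v : Var n, val v = I /\ y v != None.

Definition supp_flag_matroid (R : realType) (n : nat) (y : Point R n) : Prop :=
  exists M : nat -> {set {set 'I_n}}, flag_matroid M /\
    forall k, (1 <= k <= n.-1)%N ->
      forall X : {set 'I_n}, X \in M k <-> (supp y X /\ #|X| = k).

Definition FlDr3M_pos (R : realType) (n : nat) (y : Point R n) : Prop :=
  trop_pos (@IP_rels3 R n) y /\ supp_flag_matroid y.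

Definition trFl_pos (R : realType) (n : nat) (y : Point R n) : Prop :=
  trop_pos (@I_IP R n) y.

Definition FlDr_pos (R : realType) (n : nat) (y : Point R n) : Prop :=
  trop_pos (@IP_rels R n) y.

(* Main.v *)
Require Import Defs.
From mathcomp Require Import all_boot all_order all_algebra.
From mathcomp Require Import reals.
From mathcomp Require Import zify ring lra.
From mathcomp Require Import mpoly.
From mathcomp Require exp.

Set Implicit Arguments.
Unset Strict Implicit.
Unset Printing Implicit Defensive.
Import Order.TTheory GRing.Theory Num.Theory.
Local Open Scope ring_scope.
Local Notation expR := sequences.expR.

(* Solving a relation positively means that each of its finite terms is
   matched by a term of the opposite sign that is no larger (IPok below).

   Three-term relations imply all others when the support is a flag matroid:
   if the relation of (I, J) fails and J :\: I has more than three elements,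
   then trading some v in J :\: I for some u in I :\: J (or merely deleting v
   from J) yields a failing relation with a smaller J :\: I. Here v is found in
   the rank two valuated matroid formed by u and J :\: I.

   The tropical action of the elementary matrices 1 + t^K E_ab with a and b
   adjacent preserves the set of solutions of all the relations. For K large
   it leaves the finite coordinates alone and makes infinite ones large and
   finite, so every solution is a limit of solutions without infinite
   coordinates.

   For such a solution y and every lam >= 0 there is a real matrix whose flag
   minors on intervals are exp (- lam * y). By the three-term relations, all
   its flag minors are positive and equal to exp (- lam * y) up to a factor
   bounded independently of lam. Every p in the ideal vanishes at these minors,
   and letting lam tend to infinity shows that the minimal terms of p at y have
   both signs. *)

(** * Signs and terms of the incidence relations *)

(** Solutions are handled through partners of single terms rather than through minima, because this
    survives an action that is itself a minimum of coordinates. Partners also give symmetric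
    exchange between sets of different sizes, which is why the support of a solution of all
    relations is a flag matroid. Adjacency of a and b is needed because only then does trading b for
    a leave the signs at all other indices unchanged; for distant a and b the elementary matrix has
    negative minors. Interval minors can be prescribed freely, since each brings in a new matrix
    entry, and every other flag minor is a subtraction-free rational expression in them, so size
    estimates pass through sums, products and quotients. The quotients divide by coordinates that
    have to be finite; hence infinite coordinates are removed first. Factors bounded independently
    of lam are harmless: a non-minimal term is smaller than a minimal one by a factor exponential in
    lam. *)

Definition tadd (R : realType) (a b : trop R) : trop R :=
  match a, b with Some x, Some z => Some (x + z) | _, _ => None end.

Definition lo (n : nat) (j : 'I_n) (A : {set 'I_n}) : bool :=
  odd #|[set k in A | (k < j)%N]|.

Definition hi (n : nat) (j : 'I_n) (A : {set 'I_n}) : bool :=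
  odd #|[set k in A | (j < k)%N]|.

Definition par (n : nat) (j : 'I_n) (I J : {set 'I_n}) : bool :=
  lo j J (+) hi j I.

Definition IPterm (R : realType) (n : nat) (f : {set 'I_n} -> trop R)
  (I J : {set 'I_n}) (j : 'I_n) : trop R :=
  tadd (f (j |: I)) (f (J :\ j)).

(* The combinatorial content of "f is a positive solution of the relation
   (I, J)"; it says nothing when all terms are infinite. *)
Definition IPok (R : realType) (n : nat) (f : {set 'I_n} -> trop R)
  (I J : {set 'I_n}) : Prop :=
  forall j, j \in J :\: I -> IPterm f I J j != None ->
  exists j', [/\ j' \in J :\: I, par j' I J != par j I J &
                 tle (IPterm f I J j') (IPterm f I J j)].

Lemma odd_cardU1 (T : finType) (P : pred T) (x : T) (A : {set T}) :
  x \notin A ->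
  odd #|[set k in x |: A | P k]| = odd #|[set k in A | P k]| (+) P x.
Proof.
move=> xA; case Px: (P x); last first.
  rewrite addbF; congr (odd _); apply: eq_card => k; rewrite !inE.
  by case: eqP => [->|//]; rewrite Px andbF andbF.
have -> : [set k in x |: A | P k] = x |: [set k in A | P k].
  by apply/setP => k; rewrite !inE; case: eqP => [->|//]; rewrite Px.
by rewrite cardsU1 inE (negbTE xA) /= addbT.
Qed.

Lemma loU1 (n : nat) (j x : 'I_n) (A : {set 'I_n}) : x \notin A ->
  lo j (x |: A) = lo j A (+) (x < j)%N.
Proof. by move=> xA; rewrite /lo (odd_cardU1 (fun k : 'I_n => k < j)%N). Qed.

Lemma hiU1 (n : nat) (j x : 'I_n) (A : {set 'I_n}) : x \notin A ->
  hi j (x |: A) = hi j A (+) (j < x)%N.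
Proof. by move=> xA; rewrite /hi (odd_cardU1 (fun k : 'I_n => j < k)%N). Qed.

Lemma loD1 (n : nat) (j x : 'I_n) (A : {set 'I_n}) : x \in A ->
  lo j (A :\ x) = lo j A (+) (x < j)%N.
Proof.
by move=> xA; rewrite -{2}(setD1K xA) loU1 ?setD11 // -addbA addbb addbF.
Qed.

Lemma hiD1 (n : nat) (j x : 'I_n) (A : {set 'I_n}) : x \in A ->
  hi j (A :\ x) = hi j A (+) (j < x)%N.
Proof.
by move=> xA; rewrite -{2}(setD1K xA) hiU1 ?setD11 // -addbA addbb addbF.
Qed.

(** Each element of A other than j is on exactly one side of j. This converts counts above j into
    counts below j. *)
Lemma lo_hi (n : nat) (j : 'I_n) (A : {set 'I_n}) :
  lo j A (+) hi j A = odd #|A :\ j|.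
Proof.
rewrite /lo /hi -oddD; congr (odd _).
rewrite -cardsUI.
have -> : [set k in A | (k < j)%N] :&: [set k in A | (j < k)%N] = set0.
  apply/setP => k; rewrite !inE; lia.
rewrite cards0 addn0; apply: eq_card => k; rewrite !inE -val_eqE /=.
by case: (k \in A); lia.
Qed.

Lemma tle_refl (R : realType) (a : trop R) : tle a a.
Proof. by case: a => //= x. Qed.

Lemma tle_trans (R : realType) (b a c : trop R) : tle a b -> tle b c -> tle a c.
Proof. by case: a => [a|]; case: b => [b|]; case: c => [c|] //=; apply: le_trans. Qed.

Lemma tle_total (R : realType) (a b : trop R) : tle a b || tle b a.
Proof. by case: a => [a|]; case: b => [b|] //=; apply: le_total. Qed.

Lemma tle_add (R : realType) (a b c d : trop R) :
  tle a c -> tle b d -> tle (tadd a b) (tadd c d).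
Proof.
by case: a => [a|]; case: b => [b|]; case: c => [c|]; case: d => [d|] //=; lra.
Qed.

Lemma tleN (R : realType) (a b : trop R) : tle a b -> b != None -> a != None.
Proof. by case: a; case: b. Qed.

Lemma taddN (R : realType) (a b : trop R) :
  (tadd a b != None) = (a != None) && (b != None).
Proof. by case: a; case: b. Qed.

(** * Tropical elementary matrices *)

Definition tmin (R : realType) (a b : trop R) : trop R :=
  if tle a b then a else b.

Definition swp (n : nat) (a b : 'I_n) (A : {set 'I_n}) : {set 'I_n} :=
  a |: (A :\ b).

(* Tropical action of the one-parameter subgroup 1 + t^K E_ab. *)
Definition step (R : realType) (n : nat) (a b : 'I_n) (K : R)
  (f : {set 'I_n} -> trop R) (A : {set 'I_n}) : trop R :=
  if (b \in A) && (a \notin A) then tmin (f A) (tadd (Some K) (f (swp a b A)))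
  else f A.

Lemma tmin_lel (R : realType) (a b : trop R) : tle (tmin a b) a.
Proof.
by rewrite /tmin; case: ifP => [_|ab]; [exact: tle_refl | have := tle_total a b; rewrite ab].
Qed.

Lemma tmin_ler (R : realType) (a b : trop R) : tle (tmin a b) b.
Proof. by rewrite /tmin; case: ifP => // _; exact: tle_refl. Qed.

Lemma tmin_or (R : realType) (a b : trop R) : tmin a b = a \/ tmin a b = b.
Proof. by rewrite /tmin; case: ifP; [left|right]. Qed.

Lemma step_le (R : realType) (n : nat) (a b : 'I_n) (K : R)
  (f : {set 'I_n} -> trop R) (A : {set 'I_n}) :
  tle (step a b K f A) (f A).
Proof. by rewrite /step; case: ifP => _; [exact: tmin_lel | exact: tle_refl]. Qed.

Lemma step_le_swp (R : realType) (n : nat) (a b : 'I_n) (K : R)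
  (f : {set 'I_n} -> trop R) (A : {set 'I_n}) :
  b \in A -> a \notin A ->
  tle (step a b K f A) (tadd (Some K) (f (swp a b A))).
Proof. by move=> bA aA; rewrite /step bA aA; exact: tmin_ler. Qed.

Lemma step_or (R : realType) (n : nat) (a b : 'I_n) (K : R)
  (f : {set 'I_n} -> trop R) (A : {set 'I_n}) :
  step a b K f A = f A \/
  [/\ b \in A, a \notin A & step a b K f A = tadd (Some K) (f (swp a b A))].
Proof.
rewrite /step; case: ifP => [/andP[bA aA]|]; last by left.
by case: (tmin_or (f A) (tadd (Some K) (f (swp a b A)))) => ->; [left|right].
Qed.

(** * Signs of relations under an adjacent swap *)

Lemma loD1_if (n : nat) (j x : 'I_n) (A : {set 'I_n}) :
  lo j A = lo j (A :\ x) (+) ((x \in A) && (x < j)%N).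
Proof.
case xA: (x \in A); first by rewrite loD1 // -addbA addbb addbF.
by rewrite addbF (setDidPl _) // disjoint_sym disjoints1 xA.
Qed.

Lemma hiD1_if (n : nat) (j x : 'I_n) (A : {set 'I_n}) :
  hi j A = hi j (A :\ x) (+) ((x \in A) && (j < x)%N).
Proof.
case xA: (x \in A); first by rewrite hiD1 // -addbA addbb addbF.
by rewrite addbF (setDidPl _) // disjoint_sym disjoints1 xA.
Qed.

(** Isolates the contributions of a and b: the first two parities run over sets that a swap does not
    alter, so the sign comparisons below become finite Boolean checks. *)
Lemma parD2 (n : nat) (a b : 'I_n) (j : 'I_n) (I J : {set 'I_n}) : a != b ->
  par j I J = lo j (J :\ a :\ b) (+) hi j (I :\ a :\ b)
    (+) (((a \in J) && (a < j)%N) (+) ((b \in J) && (b < j)%N))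
    (+) (((a \in I) && (j < a)%N) (+) ((b \in I) && (j < b)%N)).
Proof.
move=> ab; rewrite /par (loD1_if j a J) (loD1_if j b (J :\ a)).
rewrite (hiD1_if j a I) (hiD1_if j b (I :\ a)) !inE eq_sym ab /=.
by move: (_ && _) (_ && _) (_ && _) (_ && _) (lo _ _) (hi _ _); do 6!case.
Qed.

Lemma lo_adj (n : nat) (a b : 'I_n) (A : {set 'I_n}) :
  (a.+1 == b) || (b.+1 == a) -> lo a (A :\ a :\ b) = lo b (A :\ a :\ b).
Proof.
move=> ab; congr (odd _); apply: eq_card => k; rewrite !inE -!val_eqE /=.
by case: (k \in A); lia.
Qed.

Lemma hi_adj (n : nat) (a b : 'I_n) (A : {set 'I_n}) :
  (a.+1 == b) || (b.+1 == a) -> hi a (A :\ a :\ b) = hi b (A :\ a :\ b).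
Proof.
move=> ab; congr (odd _); apply: eq_card => k; rewrite !inE -!val_eqE /=.
by case: (k \in A); lia.
Qed.

Lemma swpD2 (n : nat) (a b : 'I_n) (A : {set 'I_n}) :
  swp a b A :\ a :\ b = A :\ a :\ b.
Proof.
apply/setP => k; rewrite !inE.
by case: (k == a); case: (k == b); case: (k \in A).
Qed.

Lemma adj_neq (n : nat) (a b : 'I_n) : (a.+1 == b) || (b.+1 == a) -> a != b.
Proof. by rewrite -val_eqE /=; lia. Qed.

Lemma adj_lt (n : nat) (a b : 'I_n) :
  (a.+1 == b) || (b.+1 == a) -> (b < a)%N = ~~ (a < b)%N.
Proof. lia. Qed.

Lemma adj_ltr (n : nat) (a b j : 'I_n) :
  (a.+1 == b) || (b.+1 == a) -> j != a -> j != b -> (j < a)%N = (j < b)%N.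
Proof. by rewrite -!val_eqE /=; lia. Qed.

Lemma adj_ltl (n : nat) (a b j : 'I_n) :
  (a.+1 == b) || (b.+1 == a) -> j != a -> j != b -> (a < j)%N = (b < j)%N.
Proof. by rewrite -!val_eqE /=; lia. Qed.

Lemma in_swp (n : nat) (a b j : 'I_n) (A : {set 'I_n}) :
  j \in swp a b A = (j == a) || (j != b) && (j \in A).
Proof. by rewrite !inE. Qed.

Lemma par_swpI (n : nat) (a b j : 'I_n) (I J : {set 'I_n}) :
  (a.+1 == b) || (b.+1 == a) -> b \in I -> a \notin I -> j != a -> j != b ->
  par j (swp a b I) J = par j I J.
Proof.
move=> ab bI aI ja jb; rewrite !(parD2 _ _ _ (adj_neq ab)) swpD2 !in_swp eqxx.
rewrite (eq_sym b a) (negbTE (adj_neq ab)) bI (negbTE aI) /= !eqxx /=.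
by rewrite (adj_ltr ab ja jb) addbF.
Qed.

Lemma par_swpJ (n : nat) (a b j : 'I_n) (I J : {set 'I_n}) :
  (a.+1 == b) || (b.+1 == a) -> b \in J -> a \notin J -> j != a -> j != b ->
  par j I (swp a b J) = par j I J.
Proof.
move=> ab bI aI ja jb; rewrite !(parD2 _ _ _ (adj_neq ab)) swpD2 !in_swp eqxx.
rewrite (eq_sym b a) (negbTE (adj_neq ab)) bI (negbTE aI) /= !eqxx /=.
by rewrite (adj_ltl ab ja jb) addbF.
Qed.

Lemma par_adj_swpJ (n : nat) (a b : 'I_n) (I J : {set 'I_n}) :
  (a.+1 == b) || (b.+1 == a) -> b \in J -> a \notin J -> a \notin I ->
  b \notin I -> par a I (swp a b J) = par b I J.
Proof.
move=> ab bJ aJ aI bI; rewrite !(parD2 _ _ _ (adj_neq ab)) swpD2 !in_swp eqxx.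
rewrite (eq_sym b a) (negbTE (adj_neq ab)) bJ (negbTE aI) (negbTE bI).
by rewrite (negbTE aJ) /= (lo_adj J ab) (hi_adj I ab) !eqxx !ltnn.
Qed.

Lemma par_adj_swpI (n : nat) (a b : 'I_n) (I J : {set 'I_n}) :
  (a.+1 == b) || (b.+1 == a) -> b \in J -> a \in J -> a \notin I ->
  b \in I -> par b (swp a b I) J = par a I J.
Proof.
move=> ab bJ aJ aI bI; rewrite !(parD2 _ _ _ (adj_neq ab)) swpD2 !in_swp eqxx.
rewrite (eq_sym b a) (negbTE (adj_neq ab)) bJ (negbTE aI) bI.
rewrite aJ /= (lo_adj J ab) (hi_adj I ab) !eqxx !ltnn (adj_lt ab).
by case: (a < b)%N => /=; case: lo; case: hi.
Qed.

Lemma par_adj (n : nat) (a b : 'I_n) (I J : {set 'I_n}) :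
  (a.+1 == b) || (b.+1 == a) -> b \in J -> a \in J -> a \notin I ->
  b \notin I -> par b I J != par a I J.
Proof.
move=> ab bJ aJ aI bI; rewrite !(parD2 _ _ _ (adj_neq ab)).
rewrite bJ (negbTE aI) (negbTE bI).
rewrite aJ /= (lo_adj J ab) (hi_adj I ab) !ltnn (adj_lt ab).
by case: (a < b)%N => /=; case: lo; case: hi.
Qed.

(** The two terms compared here are the same product. Their opposite signs are a cancellation
    between two relations in the expansion behind [step_IPok]. *)
Lemma par_adj_swp (n : nat) (a b : 'I_n) (I J : {set 'I_n}) :
  (a.+1 == b) || (b.+1 == a) -> b \in J -> a \notin J -> a \notin I ->
  b \in I -> par b (swp a b I) J != par a I (swp a b J).
Proof.
move=> ab bJ aJ aI bI; rewrite !(parD2 _ _ _ (adj_neq ab)) !swpD2 !in_swp eqxx.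
rewrite (eq_sym b a) (negbTE (adj_neq ab)) bJ (negbTE aI) bI.
rewrite (negbTE aJ) /= (lo_adj J ab) (hi_adj I ab) !eqxx !ltnn (adj_lt ab).
by case: (a < b)%N => /=; case: lo; case: hi.
Qed.

Lemma swpU (n : nat) (a b j : 'I_n) (A : {set 'I_n}) :
  j != b -> swp a b (j |: A) = j |: swp a b A.
Proof.
move=> jb; apply/setP => k; rewrite !inE; case: (k =P j) => [->|_] /=.
  by rewrite jb orbT.
by [].
Qed.

Lemma swpU_b (n : nat) (a b : 'I_n) (A : {set 'I_n}) :
  b \notin A -> swp a b (b |: A) = a |: A.
Proof. by move=> bA; rewrite /swp setU1K. Qed.

Lemma setU1_swp (n : nat) (a b : 'I_n) (A : {set 'I_n}) :
  b \in A -> b |: swp a b A = a |: A.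
Proof. by move=> bA; rewrite /swp setUCA setD1K. Qed.

Lemma swpD (n : nat) (a b j : 'I_n) (A : {set 'I_n}) :
  j != a -> swp a b (A :\ j) = swp a b A :\ j.
Proof.
move=> ja; apply/setP => k; rewrite !inE.
by case: (k =P j) => [->|_]; rewrite ?(negbTE ja) ?andbF.
Qed.

Lemma swpD_a (n : nat) (a b : 'I_n) (A : {set 'I_n}) :
  a != b -> a \in A -> swp a b (A :\ a) = A :\ b.
Proof.
move=> ab aA; apply/setP => k; rewrite !inE.
by case: (k =P a) => [->|_] //=; rewrite ab aA.
Qed.

Lemma setD1_swp (n : nat) (a b : 'I_n) (A : {set 'I_n}) :
  a \notin A -> swp a b A :\ a = A :\ b.
Proof. by move=> aA; rewrite /swp setU1K // !inE negb_and aA orbT. Qed.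

Lemma card_swp (n : nat) (a b : 'I_n) (A : {set 'I_n}) :
  b \in A -> a \notin A -> #|swp a b A| = #|A|.
Proof.
move=> bA aA; rewrite cardsU1 (cardsD1 b A) bA.
by rewrite !inE (negbTE aA) andbF.
Qed.

Lemma taddA (R : realType) : associative (@tadd R).
Proof. by case=> [x|] [z|] [t|] //=; rewrite addrA. Qed.

Lemma taddCA (R : realType) : left_commutative (@tadd R).
Proof. by case=> [x|] [z|] [t|] //=; rewrite addrCA. Qed.

(** Expanding the relation [(I, J)] of the transformed coordinates gives the relations of f at
    [(I, J)], [(swp a b I, J)], [(I, swp a b J)] and [(swp a b I, swp a b J)], shifted by 0, K, K
    and 2K. Apart from products that occur at both a and b with opposite signs, a finite term is a
    term of one of these and has a partner there, which is carried back to [(I, J)]. *)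
Lemma step_IPok (R : realType) (n : nat) (a b : 'I_n) (K : R)
  (f : {set 'I_n} -> trop R) :
  (a.+1 == b) || (b.+1 == a) ->
  (forall I J : {set 'I_n}, (#|I| + 2 <= #|J|)%N -> IPok f I J) ->
  forall I J : {set 'I_n}, (#|I| + 2 <= #|J|)%N -> IPok (step a b K f) I J.
Proof.
move=> ab ok I J IJ; have nab := adj_neq ab; have nba : b != a by rewrite eq_sym.
set f' := step a b K f; pose k := Some K : trop R.
have U00 j : tle (IPterm f' I J j) (IPterm f I J j).
  by apply: tle_add; exact: step_le.
have U10 j : b \in j |: I -> a \notin j |: I ->
    tle (IPterm f' I J j) (tadd k (tadd (f (swp a b (j |: I))) (f (J :\ j)))).
  move=> bI aI; rewrite taddA.
  by apply: tle_add; [exact: step_le_swp | exact: step_le].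
have U01 j : b \in J :\ j -> a \notin J :\ j ->
    tle (IPterm f' I J j) (tadd k (tadd (f (j |: I)) (f (swp a b (J :\ j))))).
  move=> bI aI; rewrite taddCA.
  by apply: tle_add; [exact: step_le | exact: step_le_swp].
have FI j : b \in I -> a \notin I -> j \in J :\: swp a b I -> j != b ->
    exists j', [/\ j' \in J :\: I, par j' I J = par j (swp a b I) J &
                 tle (IPterm f' I J j') (tadd k (IPterm f (swp a b I) J j))].
  move=> bI aI; rewrite inE in_swp negb_or negb_and negbK => /andP[/andP[ja jI] jJ] jb.
  exists j; rewrite inE jJ par_swpI //; split => //.
    by move: jI; rewrite (negbTE jb) /= => ->.
  rewrite /IPterm -swpU //; apply: U10; rewrite !inE ?bI ?orbT //.
  by rewrite negb_or eq_sym ja.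
have FJ j : b \in J -> a \notin J -> j \in swp a b J :\: I -> j != a ->
    exists j', [/\ j' \in J :\: I, par j' I J = par j I (swp a b J) &
                 tle (IPterm f' I J j') (tadd k (IPterm f I (swp a b J) j))].
  move=> bJ aJ; rewrite inE in_swp => /andP[jI].
  case ja: (j == a) => //= /andP[jb jJ] _.
  exists j; rewrite inE jJ jI par_swpJ ?ja //; split => //.
  rewrite /IPterm -swpD ?ja //; apply: U01; rewrite !inE ?bJ ?(negbTE aJ) ?andbF //.
  by rewrite eq_sym jb.
have Fa : a \in J -> b \in J ->
    tle (IPterm f' I J a) (tadd k (tadd (f (a |: I)) (f (J :\ b)))).
  move=> aJ bJ; rewrite -(swpD_a nab aJ); apply: U01; rewrite !inE ?eqxx //.
  by rewrite nba.
have Fb : a \notin I -> b \notin I ->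
    tle (IPterm f' I J b) (tadd k (tadd (f (a |: I)) (f (J :\ b)))).
  move=> aI bI; rewrite -(swpU_b a bI); apply: U10; rewrite !inE ?eqxx //.
  by rewrite negb_or nab.
have EQ : b \in I -> a \notin J ->
    IPterm f (swp a b I) J b = IPterm f I (swp a b J) a.
  by move=> bI aJ; rewrite /IPterm setU1_swp // setD1_swp.
(* The partner may be b, which is not an index of [(I, J)]. If a is in J, the same product bounds
   the term a of [f']. Otherwise it cancels against the term a of [(I, swp a b J)], and the search
   goes on in that relation. *)
have LI j : b \in I -> a \notin I -> j \in J :\: swp a b I ->
    IPterm f (swp a b I) J j != None ->
    exists j', [/\ j' \in J :\: I, par j' I J != par j (swp a b I) J &
                 tle (IPterm f' I J j') (tadd k (IPterm f (swp a b I) J j))].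
  move=> bI aI jJ jN.
  have [j1 [j1J pj1 le1]] : exists j', [/\ j' \in J :\: swp a b I,
      par j' (swp a b I) J != par j (swp a b I) J &
      tle (IPterm f (swp a b I) J j') (IPterm f (swp a b I) J j)].
    by apply: ok => //; rewrite card_swp.
  have le1' := tle_add (tle_refl k) le1.
  have [j1b|j1b] := eqVneq j1 b; last first.
    have [j' [? pj' le']] := FI j1 bI aI j1J j1b.
    by exists j'; split => //; [rewrite pj' | exact: tle_trans le1'].
  subst j1; have bJ : b \in J by move: j1J; rewrite inE => /andP[].
  case aJ: (a \in J).
    exists a; split; first by rewrite inE aI aJ.
      by rewrite -(par_adj_swpI ab).
    apply: tle_trans le1'; rewrite /IPterm setU1_swp //; exact: Fa.
  move/negbT: aJ => aJ.
  have cIJ : (#|I| + 2 <= #|swp a b J|)%N by rewrite card_swp.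
  have aJI : a \in swp a b J :\: I by rewrite inE aI in_swp eqxx.
  have aN : IPterm f I (swp a b J) a != None by rewrite -EQ //; exact: tleN le1 jN.
  have [j2 [j2J pj2 le2]] := ok _ _ cIJ a aJI aN.
  have j2a : j2 != a.
    by apply: contra_neq pj2 => ->.
  have [j' [? pj' le']] := FJ j2 bJ aJ j2J j2a.
  exists j'; split => //.
    move: pj1 pj2 (par_adj_swp ab bJ aJ aI bI); rewrite pj'.
    by do 4!case: (par _ _ _).
  apply: tle_trans le' (tle_trans (tle_add (tle_refl k) le2) _).
  by rewrite -EQ.
have LJ j : b \in J -> a \notin J -> j \in swp a b J :\: I ->
    IPterm f I (swp a b J) j != None ->
    exists j', [/\ j' \in J :\: I, par j' I J != par j I (swp a b J) &
                 tle (IPterm f' I J j') (tadd k (IPterm f I (swp a b J) j))].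
  move=> bJ aJ jJ jN.
  have [j1 [j1J pj1 le1]] : exists j', [/\ j' \in swp a b J :\: I,
      par j' I (swp a b J) != par j I (swp a b J) &
      tle (IPterm f I (swp a b J) j') (IPterm f I (swp a b J) j)].
    by apply: ok => //; rewrite card_swp.
  have le1' := tle_add (tle_refl k) le1.
  have [j1a|j1a] := eqVneq j1 a; last first.
    have [j' [? pj' le']] := FJ j1 bJ aJ j1J j1a.
    by exists j'; split => //; [rewrite pj' | exact: tle_trans le1'].
  subst j1; have aI : a \notin I by move: j1J; rewrite inE => /andP[].
  case bI: (b \in I); last first.
    move/negbT: bI => bI; exists b; split; first by rewrite inE bI bJ.
      by rewrite -(par_adj_swpJ ab).
    by apply: tle_trans le1'; rewrite /IPterm setD1_swp //; exact: Fb.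
  have j1N := tleN le1 jN.
  have bJI : b \in J :\: swp a b I by rewrite inE in_swp bJ eqxx eq_sym (negbTE nab).
  have cIJ : (#|swp a b I| + 2 <= #|J|)%N by rewrite card_swp.
  have bN : IPterm f (swp a b I) J b != None by rewrite EQ.
  have [j2 [j2J pj2 le2]] := ok _ _ cIJ b bJI bN.
  have j2b : j2 != b by apply: contra_neq pj2 => ->.
  have [j' [? pj' le']] := FI j2 bI aI j2J j2b.
  exists j'; split => //.
    move: pj1 pj2 (par_adj_swp ab bJ aJ aI bI); rewrite pj'.
    by do 4!case: (par _ _ _).
  apply: tle_trans le' (tle_trans (tle_add (tle_refl k) le2) _).
  by rewrite EQ.
move=> j jJI; move: (jJI); rewrite inE => /andP[jI jJ].
have taddNr (x : trop R) : (tadd k x != None) = (x != None) by case: x.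
rewrite {1 3}/IPterm /f'.
have [->|[bA aA ->]] := step_or a b K f (j |: I).
  have [->|[bB aB ->]] := step_or a b K f (J :\ j).
    move=> jN; have [j' [? ? le']] := ok I J IJ j jJI jN.
    by exists j'; split => //; exact: tle_trans le'.
  move: bB aB; rewrite !inE negb_and negbK => /andP[bj bJ] aB.
  rewrite taddCA taddNr.
  (* At [j = a] the product is [f (a |: I) + f (J :\ b)]. It is the term b of [(swp a b I, J)] if b
     is in I; otherwise it bounds the term b of [(I, J)], whose sign is opposite. *)
  have [ja|ja] := eqVneq j a.
    subst j; rewrite (swpD_a nab jJ).
    case bI: (b \in I) => jN.
      have bJI : b \in J :\: swp a b I by rewrite inE in_swp bJ eqxx (negbTE nba).
      have bN : IPterm f (swp a b I) J b != None by rewrite /IPterm setU1_swp.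
      have [j' [? pj' le']] := LI b bI jI bJI bN.
      exists j'; split => //; first by rewrite -(par_adj_swpI ab).
      by move: le'; rewrite {2}/IPterm setU1_swp.
    move/negbT: bI => bI; exists b; split; first by rewrite inE bI bJ.
      exact: par_adj.
    exact: Fb.
  have aJ : a \notin J by move: aB; rewrite eq_sym (negbTE ja).
  rewrite swpD // => jN; have [|//|j' [? pj' le']] := LJ j bJ aJ.
    by rewrite inE jI in_swp jJ (eq_sym j b) bj orbT.
  by exists j'; split => //; rewrite -(par_swpJ _ ab bJ aJ ja) // eq_sym.
have [->|[bB aB ->]] := step_or a b K f (J :\ j).
  move: bA aA; rewrite !inE negb_or => bA /andP[aj aI].
  rewrite -taddA taddNr.
  have [jb|jb] := eqVneq j b.
    subst j; rewrite (swpU_b a jI) => jN.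
    case aJ: (a \in J).
      exists a; split; first by rewrite inE aI aJ.
        by rewrite eq_sym; apply: par_adj.
      exact: Fa.
    move/negbT: aJ => aJ; have [||j' [? pj' le']] := LJ a jJ aJ.
    - by rewrite inE aI in_swp eqxx.
    - by rewrite /IPterm setD1_swp.
    exists j'; split => //; first by rewrite -(par_adj_swpJ ab).
    by move: le'; rewrite /IPterm setD1_swp.
  have bI : b \in I by move: bA; rewrite eq_sym (negbTE jb).
  rewrite swpU // => jN; have [|//|j' [? pj' le']] := LI j bI aI.
    by rewrite inE in_swp jJ (eq_sym j a) (negbTE aj) (negbTE jI) andbF.
  by exists j'; split => //; rewrite -(par_swpI _ ab bI aI _ jb) // eq_sym.
(* Both factors come from swapped sets. Neither a nor b is an index of [(swp a b I, swp a b J)], so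
   the partner carries over unchanged. *)
move: bA aA bB aB; rewrite !inE negb_or negb_and negbK => bA /andP[aj aI].
move=> /andP[bj bJ]; rewrite (negbTE aj) orFb => aJ.
have jb : j != b by rewrite eq_sym.
have ja : j != a by rewrite eq_sym.
have bI : b \in I by move: bA; rewrite (negbTE bj).
rewrite swpU // swpD // taddCA -taddA !taddNr => jN.
have jJI' : j \in swp a b J :\: swp a b I.
  by rewrite inE !in_swp jJ (negbTE ja) (negbTE jI) jb.
have cIJ : (#|swp a b I| + 2 <= #|swp a b J|)%N by rewrite !card_swp.
have [j1 [j1J pj1 le1]] := ok _ _ cIJ j jJI' jN.
have /and4P[j1a j1b j1I j1J'] : [&& j1 != a, j1 != b, j1 \notin I & j1 \in J].
  move: j1J; rewrite inE !in_swp.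
  by case: (j1 == a); case: (j1 == b); rewrite ?andbF.
exists j1; split; first by rewrite inE j1I.
  move: pj1; rewrite (par_swpI _ ab bI aI j1a j1b) (par_swpI _ ab bI aI ja jb).
  by rewrite (par_swpJ _ ab bJ aJ j1a j1b) (par_swpJ _ ab bJ aJ ja jb).
apply: tle_trans (tle_add (tle_refl k) (tle_add (tle_refl k) le1)).
rewrite /IPterm -swpU // -swpD // (taddA k (f _) (f _)) taddCA.
apply: tle_add; apply: step_le_swp; rewrite !inE.
- by rewrite bI orbT.
- by rewrite (negbTE aI) orbF eq_sym.
- by rewrite bJ eq_sym j1b.
- by rewrite (negbTE aJ) andbF.
Qed.

(** * From three-term relations to all relations *)

Lemma tle_argmin (R : realType) (T : finType) (A : {set T}) (g : T -> trop R)
  (x0 : T) : x0 \in A ->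
  exists2 x, x \in A & forall y, y \in A -> tle (g x) (g y).
Proof.
move=> x0A; pose r : rel (trop R) := @tle R.
have rr : reflexive r by move=> ?; exact: tle_refl.
have rt : transitive r by move=> ? ? ?; exact: tle_trans.
have rT : total r by move=> ? ?; exact: tle_total.
by case: (extremumP (P := fun x => x \in A) g rr rt rT x0A) => x xA h; exists x.
Qed.

Definition tpos (R : realType) (a : trop R) : bool :=
  if a is Some x then 0 < x else true.

Lemma tposE (R : realType) (a : trop R) :
  tle (Some 0) a -> (a != Some 0) = tpos a.
Proof.
by case: a => [x|] //= x0; rewrite lt_neqAle x0 andbT eq_sym (inj_eq Some_inj).
Qed.

Lemma tadd0 (R : realType) (a : trop R) : tadd a (Some 0) = a.
Proof. by case: a => [x|] //=; rewrite addr0. Qed.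

Lemma contraction_step_new (R : realType) (evj epj dv dj : trop R) (m : R) :
  tle (Some m) epj -> tle (Some 0) dj -> tpos dv ->
  (evj != None -> tle (tadd epj dv) evj || tle (tadd (Some m) dj) evj) ->
  tle (Some m) evj /\
  (evj = Some m -> dj = Some 0 /\ ~~ tle (tadd epj dv) (Some m)).
Proof.
case: evj => [x|] //; case: epj => [z|]; case: dv => [s|]; case: dj => [t|] //=;
  move=> h1 h2 h3 /(_ isT) h; (split; first lra); case=> xm;
  (split; [first [congr Some; lra | exfalso; lra] | lra]).
Qed.

Lemma contraction_step_attained (R : realType) (x z : trop R) (m : R) :
  tle (Some m) x -> x != Some m -> tle z (Some m) || tle x (Some m) ->
  (z != None -> tle x z || tle (Some m) z) -> z = Some m.
Proof.
case: x => [x|]; case: z => [z|] //=.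
- rewrite (inj_eq Some_inj) => h1 h2 h3 /(_ isT) h4; congr Some; lra.
- rewrite (inj_eq Some_inj) => h1 h2 h3 _; exfalso; lra.
- by rewrite orbF => _ _ h1 /(_ isT) h2; congr Some; lra.
Qed.

Lemma contraction_step_old (R : realType) (evj z s dj : trop R) (m : R) :
  tle (Some m) z -> tle (Some m) s -> tle (Some 0) dj ->
  (z = Some m -> dj = Some 0) ->
  (evj != None -> tle z evj || tle (tadd s dj) evj) ->
  tle (Some m) evj /\ (evj = Some m -> dj = Some 0).
Proof.
move=> h1 h2 h3 h4; case: evj => [x|] // /(_ isT) /orP[h|h].
  move: h1 h4 h; case: z => [z|] //= h1 h4 h; split; first lra.
  by case=> xm; apply: h4; congr Some; lra.
move: h2 h3 h; case: s => [s|]; case: dj {h4} => [t|] //= h2 h3 h.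
by split; [lra | case=> xm; congr Some; lra].
Qed.

(* e p q and d p stand for the coordinates {p, q} and {p, u} of a valuated
   matroid of rank two on X together with one more point u. *)
Lemma rank2_contraction (R : realType) (T : finType) (X : {set T})
  (d : T -> trop R) (e : T -> T -> trop R) (p0 v0 : T) :
  (forall p q, e p q = e q p) ->
  (forall x, x \in X -> tle (Some 0) (d x)) ->
  (forall p q r, p \in X -> q \in X -> r \in X -> p != q -> q != r -> p != r ->
     tadd (e q r) (d p) != None ->
     tle (tadd (e p r) (d q)) (tadd (e q r) (d p)) ||
     tle (tadd (e p q) (d r)) (tadd (e q r) (d p))) ->
  p0 \in X -> v0 \in X -> v0 != p0 -> d p0 = Some 0 -> e p0 v0 != None ->
  (exists p v m, [/\ p \in X, v \in X, v != p, d p = Some 0 & e v p = Some m] /\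
     forall j, j \in X -> j != v -> tle (Some m) (e v j) /\
       (e v j = Some m ->
          d j = Some 0 /\ (j = p \/ ~~ tle (tadd (e p j) (d v)) (Some m)))) \/
  (exists m, forall v, v \in X -> d v = Some 0 ->
     (exists p, [/\ p \in X, p != v, d p = Some 0 & e v p = Some m]) /\
     forall j, j \in X -> j != v -> tle (Some m) (e v j) /\
       (e v j = Some m -> d j = Some 0)).
Proof.
move=> esym dge tri p0X v0X v0p0 dp0 ev0.
have v0D : v0 \in X :\ p0 by rewrite !inE v0p0.
have [v1 v1D v1min] := tle_argmin (e p0) v0D.
have [m em] : exists m, e p0 v1 = Some m.
  by have := tleN (v1min _ v0D) ev0; case: (e p0 v1) => // m _; exists m.
have min j : j \in X -> j != p0 -> tle (Some m) (e p0 j).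
  by move=> jX jp; rewrite -em; apply: v1min; rewrite !inE jp.
(* The outcomes differ in whether some minimiser of [e p0] is not a zero of d. If one is, it serves
   as v with [p = p0]. If none is, every zero of d serves as v with the same m, and the choice is
   left open so that it can be made to suit the signs. *)
have [/existsP[v /and4P[vX vp dv /eqP ev]]|none] :=
  boolP [exists v, [&& v \in X, v != p0, d v != Some 0 & e p0 v == Some m]].
- left; exists p0, v, m; split; first by rewrite esym.
  move=> j jX jv; have [->|jp] := eqVneq j p0.
    by rewrite esym ev; split; [exact: tle_refl | split=> //; left].
  have pv : p0 != v by rewrite eq_sym.
  have vj : v != j by rewrite eq_sym.
  have pj : p0 != j by rewrite eq_sym.
  have := tri p0 v j p0X vX jX pv vj pj.
  rewrite dp0 ev tadd0 (tposE (dge v vX)) in dv * => tr.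
  have [? h] := contraction_step_new (min j jX jp) (dge j jX) dv tr.
  by split=> // /h[? ?]; split=> //; right.
- right; exists m => v vX dv.
  have v1p : v1 != p0 by move: v1D; rewrite !inE => /andP[].
  have v1X : v1 \in X by move: v1D; rewrite !inE => /andP[].
  have dmin j : j \in X -> j != p0 -> e p0 j = Some m -> d j = Some 0.
    move=> jX jp ej; apply/eqP; apply/negPn/negP => dj.
    by case/existsP: none; exists j; rewrite jX jp dj ej eqxx.
  have dv1 := dmin _ v1X v1p em.
  have [->|vp] := eqVneq v p0.
    split; first by exists v1.
    by move=> j jX jp; split; [exact: min | exact: dmin].
  split.
    have [evp|evp] := eqVneq (e v p0) (Some m).
      by exists p0; rewrite eq_sym.
    have vv1 : v1 != v by apply: contra_neq evp => <-; rewrite esym.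
    exists v1; split => //.
    have pv1 : p0 != v1 by rewrite eq_sym.
    have := tri v p0 v1 vX p0X v1X vp pv1; rewrite eq_sym => /(_ vv1).
    have pv : p0 != v by rewrite eq_sym.
    have := tri p0 v1 v p0X v1X vX pv1 vv1 pv.
    move: (min v vX vp) evp; rewrite em dv dp0 dv1 (esym v p0) (esym v1 v) !tadd0.
    by move=> h1 h2 h3 h4; apply: contraction_step_attained h2 _ _ => //; exact: h4.
  move=> j jX jv; have [->|jp] := eqVneq j p0.
    by split => //; rewrite esym; exact: min.
  have pv : p0 != v by rewrite eq_sym.
  have vj : v != j by rewrite eq_sym.
  have pj : p0 != j by rewrite eq_sym.
  have := tri p0 v j p0X vX jX pv vj pj.
  rewrite dp0 dv !tadd0 => tr.
  exact: contraction_step_old (min j jX jp) (min v vX vp) (dge j jX) (dmin j jX jp) tr.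
Qed.

(** Failure of [IPok] in positive form, so that it can be carried from one relation to another. *)
Definition IPbad (R : realType) (n : nat) (f : {set 'I_n} -> trop R)
  (I J : {set 'I_n}) : Prop :=
  exists j, [/\ j \in J :\: I, IPterm f I J j != None &
    forall j', j' \in J :\: I -> tle (IPterm f I J j') (IPterm f I J j) ->
      par j' I J = par j I J].

Lemma IPokPn (R : realType) (n : nat) (f : {set 'I_n} -> trop R)
  (I J : {set 'I_n}) : ~ IPbad f I J -> IPok f I J.
Proof.
move=> nbad j jJI jN.
have [/existsP[j' /and3P[? ? ?]]|none] := boolP [exists j', [&& j' \in J :\: I,
    par j' I J != par j I J & tle (IPterm f I J j') (IPterm f I J j)]].
  by exists j'.
case: nbad; exists j; split=> // j' j'JI le; apply/eqP/negPn/negP => pp.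
by case/existsP: none; exists j'; apply/and3P.
Qed.

(** K is [J'] without p and j, and the counts in [J'] above and below p add up to the same parity as
    those for j. So opposite signs in [(K, J)] say that passing from J to [J'] changes [lo p] and
    [lo j] alike, and nothing else changes between [(I, J)] and [(I, J')]. *)
Lemma par_contraction (n : nat) (I I0 J : {set 'I_n}) (p j v : 'I_n) :
  p \in J -> j \in J -> p \notin I0 -> j \notin I0 -> p != v -> j != v ->
  p != j ->
  let K := I0 :|: (J :\ p :\ j :\ v) in let J' := I0 :|: (J :\ v) in
  par p K J != par j K J -> par p I J = par j I J -> par p I J' = par j I J'.
Proof.
move=> pJ jJ pI jI pv jv pj K J'.
have pJ' : p \in J' by rewrite !inE pv pJ orbT.
have jJ' : j \in J' by rewrite !inE jv jJ orbT.
have -> : K = J' :\ p :\ j.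
  apply/setP => k; rewrite !inE.
  case: (k =P p) => [->|_]; first by rewrite (negbTE pI) !andbF.
  case: (k =P j) => [->|_]; first by rewrite (negbTE jI) !andbF.
  by case: (k == v); rewrite ?andbF ?andbT.
have hp : hi p (J' :\ p :\ j) = hi p J' (+) (p < j)%N.
  by rewrite hiD1 ?hiD1 // ?ltnn ?addbF // !inE eq_sym pj jJ jv orbT.
have hj : hi j (J' :\ p :\ j) = hi j J' (+) (j < p)%N.
  by rewrite hiD1 ?hiD1 // ?ltnn ?addbF // !inE eq_sym pj jJ jv orbT.
have := lo_hi p J'; have := lo_hi j J'.
have -> : odd #|J' :\ j| = odd #|J' :\ p|.
  by congr (odd _); have := cardsD1 p J'; rewrite (cardsD1 j J') pJ' jJ' !add1n => -[].
move=> <-; rewrite /par hp hj.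
have -> : (j < p)%N = ~~ (p < j)%N by move: pj; rewrite -val_eqE /=; lia.
by case: lo; case: lo; case: lo; case: lo; case: hi; case: hi; case: hi;
  case: hi; case: (p < j)%N.
Qed.

(* The sign changes caused by trading u for v are constant on Z minus v when
   v is the first element of Z after u in the cyclic order. *)
Lemma cyclic_first (n : nat) (Z : {set 'I_n}) (u z0 : 'I_n) : z0 \in Z ->
  u \notin Z ->
  exists2 v, v \in Z & forall p q, p \in Z -> q \in Z -> p != v -> q != v ->
    (v < p)%N (+) (u < p)%N = (v < q)%N (+) (u < q)%N.
Proof.
move=> z0Z uZ; pose key (z : 'I_n) := if (u < z)%N then val z else (n + z)%N.
case: (@arg_minnP _ z0 (fun z => z \in Z) key z0Z) => v vZ vmin; exists v => //.
suff H p : p \in Z -> p != v -> (v < p)%N (+) (u < p)%N = ~~ (u < v)%N.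
  by move=> p q pZ qZ pv qv; rewrite !H.
move=> pZ pv; have := vmin p pZ; rewrite /key /=.
have up : u != p by apply: contraNneq uZ => ->.
have uv : u != v by apply: contraNneq uZ => ->.
move: up uv pv (ltn_ord v) (ltn_ord p); rewrite -!val_eqE /=.
case: (ltnP u p); case: (ltnP u v); case: (ltnP v p) => /=; lia.
Qed.

Lemma min_first (n : nat) (Z : {set 'I_n}) (z0 : 'I_n) : z0 \in Z ->
  exists2 v, v \in Z & forall p, p \in Z -> p != v -> (v < p)%N.
Proof.
move=> z0Z; case: (@arg_minnP _ z0 (fun z => z \in Z) val z0Z) => v vZ vmin.
exists v => // p pZ pv; rewrite ltn_neqAle (vmin p pZ) andbT.
by rewrite eq_sym.
Qed.

(** The sign at p changes by [v < p], and also by [u < p] when I0 consists of u. Without u the least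
    v makes these changes equal; with u the cyclically first v does. *)
Lemma par_trade (n : nat) (I I0 J : {set 'I_n}) (z0 : 'I_n) (Z : {set 'I_n}) :
  (#|I0| <= 1)%N -> [disjoint I0 & J] -> Z \subset J -> z0 \in Z ->
  exists2 v, v \in Z & forall p q, p \in Z -> q \in Z -> p != v -> q != v ->
    par p I J = par q I J ->
    par p I (I0 :|: (J :\ v)) = par q I (I0 :|: (J :\ v)).
Proof.
move=> I01 I0J ZJ z0Z; have [I00|[u uI0]] := set_0Vmem I0.
  have [v vZ vmin] := min_first z0Z; exists v => // p q pZ qZ pv qv.
  have vJ : v \in J by apply: (subsetP ZJ).
  rewrite I00 set0U /par !loD1 // !vmin // !addbT.
  by case: lo; case: lo; case: hi; case: hi.
have -> : I0 = [set u].
  by apply/eqP; rewrite eq_sym eqEcard sub1set uI0 cards1.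
have uJ : u \notin J by rewrite (disjointFr I0J).
have uZ : u \notin Z by apply: contra uJ; apply: (subsetP ZJ).
have [v vZ vmin] := cyclic_first z0Z uZ; exists v => // p q pZ qZ pv qv.
have vJ : v \in J by apply: (subsetP ZJ).
have uJv : u \notin J :\ v by rewrite !inE negb_and uJ orbT.
have := vmin p q pZ qZ pv qv.
rewrite /par !loU1 // !loD1 //.
by case: lo; case: lo; case: hi; case: hi; do 4!case: (_ < _)%N.
Qed.

(* I0 is empty or a single element of I :\: J: the new J is J minus v, of
   smaller rank, or J minus v plus u. Adding w to the coordinates makes the
   terms indexed by p a multiple of f (J :\ p), so that the minimal terms of
   the relation are the zeros of d. *)
Lemma IPbad_contract (R : realType) (n : nat) (f : {set 'I_n} -> trop R)
  (I I0 J : {set 'I_n}) :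
  I0 \subset I -> [disjoint I0 & J] -> (#|I0| <= 1)%N ->
  (forall p q r, p \in J -> q \in J -> r \in J -> p != q -> q != r -> p != r ->
     IPok f (I0 :|: (J :\ p :\ q :\ r)) J) ->
  (forall p, p \in J :\: I -> IPterm f I J p != None ->
     exists v, [/\ v \in J :\: I, v != p & f (I0 :|: (J :\ p :\ v)) != None]) ->
  IPbad f I J -> exists2 v, v \in J :\: I & IPbad f I (I0 :|: (J :\ v)).
Proof.
move=> I0I I0J I01 tri fin [j0 [j0X j0N j0bad]].
set X := J :\: I in tri fin j0X j0bad *.
have XJ j : j \in X -> j \in J by rewrite inE => /andP[].
have XI0 j : j \in J -> j \notin I0 by move=> jJ; rewrite (disjointFl I0J).
have [ps psX psmin] := tle_argmin (IPterm f I J) j0X.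
have psp := j0bad _ psX (psmin _ j0X).
have [mu Emu] : exists mu, IPterm f I J ps = Some mu.
  by have := tleN (psmin _ j0X) j0N; case: IPterm => // mu _; exists mu.
(* When [f (j |: I)] is infinite, the second value makes [d j = 1], so that an infinite term is not
   taken for a minimal one. The value 0 is arbitrary, since [d j] is then infinite. *)
pose w j := if f (j |: I) is Some c then c else
            if f (J :\ j) is Some x then mu - x + 1 else 0.
pose e p q := tadd (f (I0 :|: (J :\ p :\ q))) (Some (w p + w q)).
pose d p := tadd (f (J :\ p)) (Some (w p - mu)).
have esym p q : e p q = e q p.
  by rewrite /e addrC !setDDl (setUC [set p]).
have dge x : x \in X -> tle (Some 0) (d x).
  move=> xX; have := psmin x xX; rewrite Emu /d /IPterm /w.
  by case: (f (x |: I)) => [c|]; case: (f (J :\ x)) => [c'|] //= ?; lra.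
have d0 x : x \in X -> d x = Some 0 -> IPterm f I J x = Some mu.
  move=> xX; rewrite /d /IPterm /w.
  case: (f (x |: I)) => [c|]; case: (f (J :\ x)) => [c'|] //= [] h.
    by congr Some; lra.
  by exfalso; clear -h; lra.
have dmu x : IPterm f I J x = Some mu -> d x = Some 0.
  rewrite /d /IPterm /w.
  by case: (f (x |: I)) => [c|]; case: (f (J :\ x)) => [c'|] //= [] h; congr Some; lra.
have dpar x : x \in X -> d x = Some 0 -> par x I J = par j0 I J.
  move=> xX dx; apply: j0bad => //; rewrite (d0 x xX dx) -Emu; exact: psmin.
have K3 p q r : p \in J -> p != q -> p != r ->
    p |: (I0 :|: (J :\ p :\ q :\ r)) = I0 :|: (J :\ q :\ r).
  move=> pJ pq pr; apply/setP => k; rewrite !inE.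
  by case: (k =P p) => [->|_]; rewrite ?pJ ?pq ?pr ?orbT.
have J3 p q r j : j \in J :\: (I0 :|: (J :\ p :\ q :\ r)) ->
    [\/ j = p, j = q | j = r].
  rewrite !inE negb_or !negb_and !negbK => /andP[/andP[_ h] jJ].
  by move: h; rewrite jJ orbF => /or3P[] /eqP; [constructor 3|constructor 2|constructor 1].
have X3 p q r j : j \in J -> [\/ j = p, j = q | j = r] ->
    j \in J :\: (I0 :|: (J :\ p :\ q :\ r)).
  move=> jJ h; rewrite !inE jJ (negbTE (XI0 _ jJ)) /=.
  by case: h => ->; rewrite eqxx ?andbF.
have DC (A : {set 'I_n}) x z : A :\ x :\ z = A :\ z :\ x.
  by rewrite !setDDl (setUC [set x]).
(* The added constant is symmetric in p, q, r, so the three-term relations of f become those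
   required of e and d. *)
have edT p q r : p \in J -> p != q -> p != r -> tadd (e q r) (d p) =
    tadd (IPterm f (I0 :|: (J :\ p :\ q :\ r)) J p) (Some (w p + w q + w r - mu)).
  move=> pJ pq pr; rewrite /e /d /IPterm K3 //.
  by case: (f (I0 :|: _)) => [x|]; case: (f _) => [z|] //=; congr Some; lra.
have edle (a b : trop R) (s : R) : tle (tadd a (Some s)) (tadd b (Some s)) = tle a b.
  by case: a => [a|]; case: b => [b|] //=; rewrite lerD2r.
have edN (a : trop R) (s : R) : (tadd a (Some s) != None) = (a != None) by case: a.
have triw p q r : p \in X -> q \in X -> r \in X -> p != q -> q != r -> p != r ->
    tadd (e q r) (d p) != None -> exists j,
    [/\ j = q \/ j = r, par j (I0 :|: (J :\ p :\ q :\ r)) J !=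
      par p (I0 :|: (J :\ p :\ q :\ r)) J & tle
      (if j == q then tadd (e p r) (d q) else tadd (e p q) (d r))
      (tadd (e q r) (d p))].
  move=> pX qX rX pq qr pr; have [pJ qJ rJ] := And3 (XJ p pX) (XJ q qX) (XJ r rX).
  rewrite (edT p q r) // edN => pN.
  have [|j [jJ jpar jle]] := tri p q r pJ qJ rJ pq qr pr p _ pN.
    by apply: X3 => //; constructor 1.
  exists j; split => //.
    by case: (J3 _ _ _ _ jJ) jpar => ->; rewrite ?eqxx //; [left | right].
  case: (J3 _ _ _ _ jJ) jpar jle => ->; rewrite ?eqxx // => _ jle.
    by rewrite (edT q p r) // 1?eq_sym // (DC J q p) (addrC (w q)) edle.
  rewrite (eq_sym r) (negbTE qr) (edT r p q) // 1?eq_sym // (DC J r p) (DC (J :\ p) r q).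
  rewrite (_ : w r + w p + w q = w p + w q + w r) ?edle //; lra.
have [|v0 [v0X v0ps v0N]] := fin ps psX; first by rewrite Emu.
have triw' p q r : p \in X -> q \in X -> r \in X -> p != q -> q != r -> p != r ->
    tadd (e q r) (d p) != None ->
    tle (tadd (e p r) (d q)) (tadd (e q r) (d p)) ||
    tle (tadd (e p q) (d r)) (tadd (e q r) (d p)).
  move=> pX qX rX pq qr pr N; have [j [+ _ +]] := triw p q r pX qX rX pq qr pr N.
  by case=> ->; rewrite ?eqxx ?(eq_sym r) ?(negbTE qr) => ->; rewrite ?orbT.
have eN : e ps v0 != None by rewrite edN.
have J'X v j : v \in X -> (j \in (I0 :|: (J :\ v)) :\: I) = (j \in X) && (j != v).
  move=> vX; rewrite !inE; case jI: (j \in I) => //=.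
  have -> : j \in I0 = false by apply/negP => /(subsetP I0I); rewrite jI.
  by rewrite andbC.
have J'T v j : v \in X -> j \in X -> j != v ->
    IPterm f I (I0 :|: (J :\ v)) j = tadd (f (j |: I)) (f (I0 :|: (J :\ v :\ j))).
  move=> vX jX jv; rewrite /IPterm; congr (tadd _ (f _)); apply/setP => k.
  rewrite !inE; case: (k =P j) => [->|_] //=.
  by rewrite (negbTE (XI0 _ (XJ _ jX))).
(* Where [f (j |: I)] is finite, the term j of the new relation is [e v j - w v]. Its minimal terms
   are thus among the minimisers of [e v], and failure only requires their signs to agree. *)
have main v p m : v \in X -> p \in X -> p != v -> d p = Some 0 -> e v p = Some m ->
    (forall j, j \in X -> j != v -> tle (Some m) (e v j)) ->
    (forall j, j \in X -> j != v -> e v j = Some m ->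
       par j I (I0 :|: (J :\ v)) = par p I (I0 :|: (J :\ v))) ->
    IPbad f I (I0 :|: (J :\ v)).
  move=> vX pX pv dp evp mle mpar.
  have [c [cE wp]] : exists c, f (p |: I) = Some c /\ w p = c.
    have := d0 p pX dp; rewrite /IPterm /w.
    by case: (f (p |: I)) => // c _; exists c.
  move: evp; rewrite /e wp; case xE: (f (I0 :|: _)) => [x|] //= [xm].
  exists p; rewrite J'X // pX pv (J'T v p) // cE xE; split => // j.
  rewrite J'X // => /andP[jX jv]; rewrite !J'T // => le.
  apply: mpar => //; move: le (mle j jX jv); rewrite /e /w.
  case: (f (j |: I)) => [c'|] //=; case: (f (I0 :|: _)) => [x'|] //=.
  rewrite -/(w v) => h1 h2; congr Some; clear -xm h1 h2; lra.
have [[p [v [m [[pX vX vp dp evp] H]]]]|[m H]] :=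
  rank2_contraction esym dge triw' psX v0X v0ps (dmu _ Emu) eN.
- exists v => //; apply: (main v p m) => //; first by rewrite eq_sym.
    by move=> j jX jv; case: (H j jX jv).
  move=> j jX jv ej; have [_ /(_ ej)[dj hj]] := H j jX jv.
  case: hj => [->//|hj]; have [->//|jp] := eqVneq j p.
  have ejm : tadd (e j v) (d p) = Some m by rewrite esym ej dp tadd0.
  have pv : p != v by rewrite eq_sym.
  have vj : v != j by rewrite eq_sym.
  have pj : p != j by rewrite eq_sym.
  have jJ := XJ j jX; have pJ := XJ p pX.
  have N : tadd (e j v) (d p) != None by rewrite ejm.
  (* In the three-term relation on p, j, v the term v is too large, so the partner of p is j, and p
     and j have opposite signs there. *)
  have [x [xE]] := triw p j v pX jX vX pj jv pv N; rewrite ejm.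
  case: xE => ->; last by rewrite (negbTE vj) (negbTE hj).
  rewrite eq_sym => xpar _; apply: Logic.eq_sym.
  apply: par_contraction xpar _ => //; rewrite ?XI0 //.
  by rewrite !dpar.
- pose Z := [set z in X | d z == Some 0].
  have psZ : ps \in Z by rewrite inE psX (dmu _ Emu) eqxx.
  have ZJ : Z \subset J by apply/subsetP => z; rewrite inE => /andP[/XJ].
  have [v vZ hv] := par_trade I I01 I0J ZJ psZ.
  move: (vZ); rewrite inE => /andP[vX /eqP dv]; exists v => //.
  have [[p [pX pv dp evp]] mle] := H v vX dv.
  apply: (main v p m) => // j jX jv; have [? h] := mle j jX jv => // ej.
  have dj := h ej.
  have jZ : j \in Z by rewrite inE jX dj eqxx.
  have pZ : p \in Z by rewrite inE pX dp eqxx.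
  by apply: hv => //; rewrite !dpar.
Qed.

(** Elements of B2 outside [A :|: B1] are exchanged one at a time for elements of B1; no element of
    A is lost. *)
Lemma basis_between (n : nat) (B : pred {set 'I_n}) (k : nat)
  (A B1 B2 : {set 'I_n}) :
  (forall C D x, B C -> B D -> #|C| = k -> #|D| = k -> x \in C :\: D ->
     exists2 z, z \in D :\: C & B (z |: (C :\ x))) ->
  B B1 -> B B2 -> #|B1| = k -> #|B2| = k -> A \subset B2 ->
  exists C, [/\ B C, #|C| = k, A \subset C & C \subset A :|: B1].
Proof.
move=> ex bB1 bB2 c1.
move: {2}#|B2 :\: (A :|: B1)| (leqnn #|B2 :\: (A :|: B1)|) => m.
elim: m B2 bB2 => [|m IH] B2 bB2 hm c2 AB2.
  exists B2; split=> //; rewrite -setD_eq0 -cards_eq0; lia.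
have [e0|[x]] := set_0Vmem (B2 :\: (A :|: B1)).
  by apply: (IH B2) => //; rewrite e0 cards0.
rewrite !inE negb_or => /andP[/andP[xA xB1] xB2].
have [|z] := ex B2 B1 x bB2 bB1 c2 c1; first by rewrite inE xB1.
rewrite inE => /andP[zB2 zB1] bC; apply: IH bC _ _ _.
- rewrite -ltnS; apply: leq_trans hm; apply: proper_card; apply/properP; split.
    apply/subsetP => k'; rewrite !inE => /andP[h /orP[/eqP kz|/andP[_ ->]]].
      by move: h; rewrite kz zB1 orbT.
    by rewrite h.
  exists x; first by rewrite !inE negb_or xA xB1.
  rewrite !inE eqxx /= orbF negb_and; apply/orP; right.
  by apply: contraNneq xB1 => ->.
- by rewrite cardsU1 !inE (negbTE zB2) andbF /= -c2 (cardsD1 x B2) xB2.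
- apply/subsetP => a aA; rewrite !inE (subsetP AB2 _ aA) andbT.
  by apply/orP; right; apply: contraNneq xA => <-.
Qed.

Lemma card3_term (n : nat) (I0 J : {set 'I_n}) (p q r : 'I_n) :
  [disjoint I0 & J] -> p \in J -> q \in J -> r \in J ->
  p != q -> q != r -> p != r ->
  let K := I0 :|: (J :\ p :\ q :\ r) in
  (#|K| = #|I0| + (#|J| - 3))%N /\ #|J :\: K| = 3%N /\ (3 <= #|J|)%N.
Proof.
move=> I0J pJ qJ rJ pq qr pr K.
have h1 := cardsD1 p J; have h2 := cardsD1 q (J :\ p).
have h3 := cardsD1 r (J :\ p :\ q).
rewrite pJ add1n in h1; rewrite !inE qJ eq_sym pq add1n in h2.
rewrite !inE rJ (eq_sym r) qr (eq_sym r) pr add1n in h3.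
have cK : (#|K| = #|I0| + (#|J| - 3))%N.
  rewrite cardsU (_ : I0 :&: _ = set0) ?cards0 ?subn0.
    by rewrite h1 h2 h3 !subSS subn0.
  apply/setP => k; rewrite !inE; case kI: (k \in I0) => //=.
  by rewrite (disjointFr I0J kI) !andbF.
split=> //; split; last by rewrite h1 h2 h3.
have -> : J :\: K = [set p; q; r].
  apply/setP => k; rewrite !inE.
  case: (k =P p) => [->|_]; first by rewrite pJ (disjointFl I0J pJ) /= !andbF.
  case: (k =P q) => [->|_]; first by rewrite qJ (disjointFl I0J qJ) /= !andbF.
  case: (k =P r) => [->|_]; first by rewrite rJ (disjointFl I0J rJ) /=.
  by rewrite /=; case: (k \in J); rewrite ?orbT ?andbF.
by rewrite -setUA cardsU1 !inE negb_or pq pr cards2 qr.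
Qed.

(** The sizes force J to be I with two more elements; the two terms are then the same product with
    opposite signs. *)
Lemma IPok_card2 (R : realType) (n : nat) (f : {set 'I_n} -> trop R)
  (I J : {set 'I_n}) :
  (#|I| + 2 <= #|J|)%N -> (#|J :\: I| <= 2)%N -> IPok f I J.
Proof.
move=> IJ D2 j jD jN.
have h2 : (#|J :&: I| <= #|I|)%N by apply/subset_leq_card/subsetIr.
have IsubJ : I \subset J.
  apply/setIidPr/eqP; rewrite eqEcard subsetIr /=.
  by rewrite -(leq_add2r 2) (leq_trans IJ) // -(cardsID I J) leq_add2l.
have D2' : (2 <= #|J :\: I|)%N.
  by rewrite -(leq_add2l #|J :&: I|) cardsID (leq_trans _ IJ) // leq_add2r.
have : (0 < #|(J :\: I) :\ j|)%N by rewrite (cardsD1 j) jD in D2'.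
case/card_gt0P => i; rewrite !inE => /and3P[ij iI iJ].
move: jD; rewrite inE => /andP[jI jJ].
have EJ : J = i |: (j |: I).
  apply/eqP; rewrite eq_sym eqEcard; apply/andP; split.
    by rewrite !subUset !sub1set iJ jJ.
  rewrite -(cardsID I J) (leq_trans (leq_add h2 D2)) //.
  by rewrite !cardsU1 !inE negb_or ij (negbTE jI) (negbTE iI) !add1n addn2.
exists i; split; first by rewrite inE iI.
  have ijI : i \notin j |: I by rewrite !inE negb_or ij.
  have := lo_hi i I; have := lo_hi j I.
  rewrite EJ /par !loU1 // !ltnn !addbF.
  have -> : I :\ i = I by apply/setDidPl; rewrite disjoint_sym disjoints1.
  have -> : I :\ j = I by apply/setDidPl; rewrite disjoint_sym disjoints1.
  have -> : (j < i)%N = ~~ (i < j)%N by move: ij; rewrite -val_eqE /=; lia.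
  move=> <-; case: (i < j)%N; case: lo; case: hi; case: lo; case: hi => //.
rewrite /IPterm.
have -> : J :\ i = j |: I by rewrite EJ setU1K // !inE negb_or ij.
have -> : J :\ j = i |: I.
  by rewrite EJ setUCA setU1K // !inE negb_or eq_sym ij.
by case: (f _) => [x|]; case: (f _) => [z|] //=; rewrite addrC.
Qed.

Lemma IPbad_not_ok (R : realType) (n : nat) (f : {set 'I_n} -> trop R)
  (I J : {set 'I_n}) : IPbad f I J -> IPok f I J -> False.
Proof.
move=> [j [jD jN h]] ok; have [j' [j'D /eqP pp le]] := ok j jD jN.
exact: pp (h _ j'D le).
Qed.

(** C omits a single element v of [I0 :|: (J :\ p)], and the sets contained in C force v into
    [J :\: I]. This turns a basis found by exchange into the finite coordinate that [IPbad_contract]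
    asks for at p. *)
Lemma pick_missing (R : realType) (n : nat) (f : {set 'I_n} -> trop R)
  (I I0 J C : {set 'I_n}) (p : 'I_n) :
  p \in J -> [disjoint I0 & J] -> C \subset I0 :|: (J :\ p) ->
  #|I0 :|: (J :\ p)| = #|C|.+1 -> I :&: J \subset C -> I0 \subset C ->
  f C != None ->
  exists v, [/\ v \in J :\: I, v != p & f (I0 :|: (J :\ p :\ v)) != None].
Proof.
move=> pJ I0J CS cS IJC I0C fC.
have : (0 < #|(I0 :|: (J :\ p)) :\: C|)%N by rewrite cardsD (setIidPr CS) cS subSnn.
case/card_gt0P => v; rewrite !inE => /andP[vC].
have vI0 : v \notin I0 by apply: contra vC; apply: (subsetP I0C).
rewrite (negbTE vI0) /= => /andP[vp vJ].
have vI : v \notin I.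
  by apply: contra vC => vI; apply: (subsetP IJC); rewrite inE vI.
exists v; split => //; first by rewrite inE vI.
suff <- : C = I0 :|: (J :\ p :\ v) by [].
have E : I0 :|: (J :\ p :\ v) = (I0 :|: (J :\ p)) :\ v.
  apply/setP => k; rewrite !inE; case: (k =P v) => [->|_] //=.
  by rewrite (negbTE vI0).
apply/eqP; rewrite eqEcard E subsetD1 CS vC /=.
by rewrite -ltnS -cS (cardsD1 v) !inE (negbTE vI0) vp vJ.
Qed.

(** Induction on the size of [J :\: I]. Trading in some u of [I :\: J] keeps the size of J. If I
    lies in J there is no such u and J shrinks, which the size condition permits because [J :\: I]
    has at least four elements. *)
Lemma three_term_IPok (R : realType) (n : nat) (f : {set 'I_n} -> trop R) :
  (forall X, f X != None -> (0 < #|X| < n)%N) ->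
  (forall C D x, f C != None -> f D != None -> #|C| = #|D| -> x \in C :\: D ->
     exists2 z, z \in D :\: C & f (z |: (C :\ x)) != None) ->
  (forall X k, f X != None -> (#|X| <= k)%N -> (k < n)%N ->
     exists Y, [/\ f Y != None, #|Y| = k & X \subset Y]) ->
  (forall Y k, f Y != None -> (0 < k <= #|Y|)%N ->
     exists X, [/\ f X != None, #|X| = k & X \subset Y]) ->
  (forall I J : {set 'I_n}, (#|I| + 2 <= #|J|)%N -> #|J :\: I| = 3%N ->
     IPok f I J) ->
  forall I J : {set 'I_n}, (#|I| + 2 <= #|J|)%N -> IPok f I J.
Proof.
move=> fc ex up down three I J; move: {2}#|J :\: I| (erefl #|J :\: I|) => m.
elim: m I J => [|m IH] I J hm IJ; first by apply: IPok_card2; rewrite ?hm.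
have [m2|m2] := leqP m.+1 2; first by apply: IPok_card2; rewrite ?hm.
have [m3|m3] := leqP m.+1 3; first by apply: three => //; rewrite hm; lia.
apply: IPokPn => bad.
have ex' k C D x : f C != None -> f D != None -> #|C| = k -> #|D| = k ->
    x \in C :\: D -> exists2 z, z \in D :\: C & f (z |: (C :\ x)) != None.
  by move=> fC fD <- cD; apply: ex.
have [/eqP|[u]] := set_0Vmem (I :\: J).
  rewrite setD_eq0 => IsubJ.
  have I0J : [disjoint (set0 : {set 'I_n}) & J] by rewrite -setI_eq0 set0I.
  have cJ : (#|I| + 4 <= #|J|)%N.
    by rewrite -(cardsID I J) hm (setIidPr IsubJ) leq_add2l.
  have [||p jD pN|v vD bad'] := IPbad_contract (sub0set I) I0J _ _ _ bad.
  - by rewrite cards0.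
  - move=> p q r pJ qJ rJ pq qr pr; apply: three.
      by have [-> _] := card3_term I0J pJ qJ rJ pq qr pr; rewrite cards0; lia.
    by have [_ [-> _]] := card3_term I0J pJ qJ rJ pq qr pr.
  - move: (jD); rewrite inE => /andP[pI pJ].
    move: pN; rewrite taddN => /andP[fI fJ].
    have cp : #|p |: I| = #|I|.+1 by rewrite cardsU1 pI.
    have cJp : #|J| = #|J :\ p|.+1 by rewrite (cardsD1 p) pJ.
    have /andP[_ sn] := fc _ fJ.
    (* In rank [#|J| - 2] the support has a set containing [p |: I] and a set inside [J :\ p], hence
       one between I and [J :\ p]. *)
    have [||B2 [fB2 cB2 IB2]] := up (p |: I) (#|J :\ p|.-1) fI.
    - by rewrite cp; move: cJ; rewrite cJp; lia.
    - exact: leq_ltn_trans (leq_pred _) sn.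
    have [|B1 [fB1 cB1 B1J]] := down (J :\ p) (#|J :\ p|.-1) fJ.
      by move: cJ; rewrite cJp; lia.
    have IB2' := subset_trans (subsetUr [set p] I) IB2.
    have [C [fC cC IC CB]] := basis_between (ex' _) fB1 fB2 cB1 cB2 IB2'.
    have IJp : I \subset J :\ p by rewrite subsetD1 IsubJ pI.
    apply: (pick_missing (C := C)) => //.
    - by rewrite set0U (subset_trans CB) // subUset IJp.
    - by rewrite set0U cC prednK // -ltnS -cJp (leq_trans _ cJ) // addn4.
    - exact: subset_trans (subsetIl I J) IC.
    - by apply: (subset_trans (sub0set _)).
  have := IH I (set0 :|: (J :\ v)); rewrite set0U in bad' *.
  move: (vD); rewrite inE => /andP[vI vJ] IH'; apply: (IPbad_not_ok bad'); apply: IH'.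
    rewrite setDDl setUC -setDDl; apply: succn_inj.
    by rewrite -hm (cardsD1 v (J :\: I)) vD.
  by move: cJ; rewrite (cardsD1 v J) vJ; lia.
rewrite inE => /andP[uJ uI].
have u1I : [set u] \subset I by rewrite sub1set.
have I0J : [disjoint [set u] & J] by rewrite disjoints1.
have [||p jD pN|v vD bad'] := IPbad_contract u1I I0J _ _ _ bad.
- by rewrite cards1.
- move=> p q r pJ qJ rJ pq qr pr; apply: three.
    by have [-> [_ ?]] := card3_term I0J pJ qJ rJ pq qr pr; rewrite cards1; lia.
  by have [_ [-> _]] := card3_term I0J pJ qJ rJ pq qr pr.
- move: (jD); rewrite inE => /andP[pI pJ].
  move: pN; rewrite taddN => /andP[fI fJ].
  have cp : #|p |: I| = #|I|.+1 by rewrite cardsU1 pI.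
  have cJp : #|J| = #|J :\ p|.+1 by rewrite (cardsD1 p) pJ.
  have /andP[_ sn] := fc _ fJ.
  have [||B2 [fB2 cB2 IB2]] := up (p |: I) #|J :\ p| fI => //.
    by rewrite cp; move: IJ; rewrite cJp; lia.
  have AB2 : u |: (I :&: J) \subset B2.
    rewrite subUset sub1set (subsetP IB2) ?inE ?uI ?orbT //=.
    by rewrite (subset_trans _ IB2) // (subset_trans (subsetIl I J)) // subsetUr.
  have [C [fC cC AC CB]] := basis_between (ex' _) fJ fB2 erefl cB2 AB2.
  have IJp : I :&: J \subset J :\ p by rewrite subsetD1 subsetIr inE (negbTE pI).
  apply: (pick_missing (C := C)) => //.
  - apply: subset_trans CB _; rewrite subUset subsetUr andbT.
    by rewrite subUset sub1set !inE eqxx /= (subset_trans IJp) // subsetUr.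
  - by rewrite cC cardsU1 !inE (negbTE uJ) andbF.
  - exact: subset_trans (subsetUr _ _) AC.
  - exact: subset_trans (subsetUl _ _) AC.
move: (vD); rewrite inE => /andP[vI vJ].
have uJv : u \notin J :\ v by rewrite !inE (negbTE uJ) andbF.
apply: (IPbad_not_ok bad'); apply: IH.
  have -> : (u |: (J :\ v)) :\: I = (J :\: I) :\ v.
    apply/setP => k; rewrite !inE; case: (k =P u) => [->|_] /=.
      by rewrite uI andbF.
    by rewrite andbCA.
  by apply: succn_inj; rewrite -hm (cardsD1 v (J :\: I)) vD.
by rewrite cardsU1 uJv (leq_trans IJ) // (cardsD1 v J) vJ.
Qed.

(** * Flag minors of real matrices *)

(** Exterior product of c with w in coordinates: [lo a A] counts the elements that a passes when
    sorted into [A :\ a] from the front. *)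
Definition wedge (R : realType) (n : nat) (c : 'I_n -> R)
  (w : {set 'I_n} -> R) (A : {set 'I_n}) : R :=
  \sum_(a in A) (-1) ^+ lo a A * c a * w (A :\ a).

(* Up to a sign depending only on k, the minor of the matrix with columns
   c 0, ..., c k.-1 in the rows A (and 0 when #|A| != k). *)
Fixpoint minor (R : realType) (n : nat) (c : nat -> 'I_n -> R) (k : nat) :
  {set 'I_n} -> R :=
  if k is k'.+1 then wedge (c k') (minor c k') else fun A => (A == set0)%:R.

(** Interior product with the dual basis vector of j, taken from the right; hence the sign counts
    elements above j. *)
Definition contr (R : realType) (n : nat) (j : 'I_n) (w : {set 'I_n} -> R)
  (I : {set 'I_n}) : R :=
  if j \in I then 0 else (-1) ^+ hi j I * w (j |: I).

Lemma eq_wedge (R : realType) (n : nat) (c c' : 'I_n -> R)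
  (w w' : {set 'I_n} -> R) (A : {set 'I_n}) :
  {in A, c =1 c'} -> w =1 w' -> wedge c w A = wedge c' w' A.
Proof. by move=> cc ww; apply: eq_bigr => a aA; rewrite cc // ww. Qed.

Lemma wedge_anti (R : realType) (n : nat) (c c' : 'I_n -> R)
  (w : {set 'I_n} -> R) (A : {set 'I_n}) :
  wedge c (wedge c' w) A = - wedge c' (wedge c w) A.
Proof.
rewrite /wedge.
under eq_bigr => a aA do rewrite mulr_sumr.
rewrite (exchange_big_dep (fun a => a \in A)) /=; last first.
  by move=> a b _; rewrite inE => /andP[].
rewrite -sumrN; apply: eq_bigr => b bA; rewrite mulr_sumr -sumrN.
rewrite (eq_bigl (fun a => a \in A :\ b)); last first.
  by move=> a; rewrite !inE bA andbT eq_sym andbC.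
apply: eq_bigr => a; rewrite !inE => /andP[ab aA].
rewrite !loD1 // !setDDl (setUC [set a]) !signr_addb.
have -> : (a < b)%N = ~~ (b < a)%N by move: ab; rewrite -val_eqE /=; lia.
by rewrite signrN; ring.
Qed.

Lemma wedge_sq (R : realType) (n : nat) (c : 'I_n -> R)
  (w : {set 'I_n} -> R) (A : {set 'I_n}) : wedge c (wedge c w) A = 0.
Proof. by have := wedge_anti c c w A; lra. Qed.

Lemma wedge0 (R : realType) (n : nat) (c : 'I_n -> R)
  (w : {set 'I_n} -> R) (A : {set 'I_n}) : w =1 (fun=> 0) -> wedge c w A = 0.
Proof. by move=> w0; apply: big1 => a _; rewrite w0 mulr0. Qed.

Lemma wedge_minor0 (R : realType) (n : nat) (c : nat -> 'I_n -> R) (i k : nat) :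
  (i < k)%N -> wedge (c i) (minor c k) =1 (fun=> 0).
Proof.
elim: k => // k IH; rewrite ltnS leq_eqVlt => /orP[/eqP->|ik] A /=.
  exact: wedge_sq.
by rewrite wedge_anti wedge0 ?oppr0 //; apply: IH.
Qed.

Lemma contr_wedge (R : realType) (n : nat) (j : 'I_n) (c : 'I_n -> R)
  (w : {set 'I_n} -> R) (I : {set 'I_n}) :
  contr j (wedge c w) I = (-1) ^+ odd #|I| * c j * w I +
    \sum_(a in I) (-1) ^+ lo a I * c a * contr j w (I :\ a).
Proof.
rewrite {1}/contr; case: ifP => jI.
  rewrite (bigD1 j) //= big1 ?addr0 => [|a /andP[aI aj]]; last first.
    by rewrite /contr !inE eq_sym aj jI mulr0.
  rewrite /contr setD11 setD1K // hiD1 // ltnn addbF.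
  have := lo_hi j I; have -> : odd #|I| = ~~ odd #|I :\ j| by rewrite (cardsD1 j) jI.
  by move=> <-; rewrite signrN signr_addb; ring.
move/negbT: jI => jI; rewrite /wedge big_setU1 //= mulrDr setU1K //; congr (_ + _).
  rewrite loU1 // ltnn addbF.
  have <- : lo j I (+) hi j I = odd #|I|.
    by rewrite lo_hi (setDidPl _) // disjoint_sym disjoints1.
  by rewrite signr_addb; ring.
rewrite mulr_sumr; apply: eq_bigr => a aI.
have aj : a != j by apply: contraNneq jI => <-.
rewrite /contr !inE (negbTE jI) andbF loU1 // hiD1 // !signr_addb.
have -> : (j |: I) :\ a = j |: (I :\ a).
  apply/setP => k; rewrite !inE; case: (k =P j) => [->|_] //=.
  by rewrite eq_sym aj.
by ring.
Qed.

(** Induction on r by the Leibniz rule [contr_wedge]. Contracting the last column [c r] assembles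
    [wedge (c r) (minor c s)] at J, which is 0 because [c r] is already a column of the second
    minor; the remaining sums are relations for r. *)
Lemma minor_incidence (R : realType) (n : nat) (c : nat -> 'I_n -> R)
  (r s : nat) (I J : {set 'I_n}) : (r <= s)%N ->
  \sum_(j in J :\: I) (-1) ^+ par j I J *
     (minor c r (j |: I) * minor c s (J :\ j)) = 0.
Proof.
move=> rs; transitivity (\sum_(j in J) (-1) ^+ lo j J * contr j (minor c r) I *
    minor c s (J :\ j)).
  rewrite [RHS](big_setID I) /= [X in _ = X + _]big1 ?add0r; last first.
    by move=> j; rewrite inE /contr => /andP[_ ->]; rewrite mulr0 mul0r.
  apply: eq_bigr => j; rewrite inE /contr => /andP[/negbTE-> _].
  by rewrite /par signr_addb; ring.
elim: r rs I => [|r IH] rs I /=.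
  apply: big1 => j _; rewrite /contr; case: ifP => _; first by rewrite mulr0 mul0r.
  have -> : (j |: I == set0) = false by apply/negbTE/set0Pn; exists j; rewrite setU11.
  by rewrite !mulr0 mul0r.
under eq_bigr => j _ do rewrite contr_wedge mulrDr mulrDl mulr_sumr mulr_suml.
rewrite big_split /= exchange_big /= [X in _ + X]big1 ?addr0; last first.
  move=> a aI; have := IH (ltnW rs) (I :\ a).
  move=> /(congr1 (fun x => (-1) ^+ lo a I * c r a * x)); rewrite mulr0; apply: etrans.
  by rewrite [RHS]mulr_sumr; apply: eq_bigr => j _; ring.
have := wedge_minor0 c rs J.
move=> /(congr1 (fun x => (-1) ^+ odd #|I| * minor c r I * x)); rewrite mulr0; apply: etrans.
by rewrite /wedge [RHS]mulr_sumr; apply: eq_bigr => j _; ring.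
Qed.

(** * Prescribing minors on intervals *)

Definition intv (n i k : nat) : {set 'I_n} := [set x : 'I_n | (i <= x < i + k)%N].

Lemma card_intv (n i k : nat) : (i + k <= n)%N -> #|intv n i k| = k.
Proof.
elim: k => [|k IH] ik.
  by apply/eqP; rewrite cards_eq0; apply/eqP/setP => x; rewrite !inE; lia.
have ikn : (i + k < n)%N by rewrite -addnS.
have -> : intv n i k.+1 = Ordinal ikn |: intv n i k.
  by apply/setP => x; rewrite !inE -val_eqE /=; lia.
by rewrite cardsU1 inE /= ltnn andbF IH //; lia.
Qed.

Lemma minor_ext (R : realType) (n : nat) (c c' : nat -> 'I_n -> R) (k : nat) :
  (forall j, (j < k)%N -> c j = c' j) -> minor c k =1 minor c' k.
Proof.
elim: k => // k IH cc A /=; rewrite cc //; apply: eq_wedge => // B.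
by apply: IH => j jk; apply: cc; apply: ltnW.
Qed.

(** A triangular linear system: ordered by starting point, the intervals first meet the entry of c
    at [m + k] in the one starting at m, with coefficient [w (intv n m k)] up to sign. *)
Lemma solve_wedge (R : realType) (n k : nat) (w : {set 'I_n} -> R)
  (g : nat -> R) :
  (forall i, (i + k <= n)%N -> w (intv n i k) != 0) ->
  exists c, forall i, (i + k.+1 <= n)%N -> wedge c w (intv n i k.+1) = g i.
Proof.
move=> w0; suff H m : exists c : 'I_n -> R, forall i, (i < m)%N ->
    (i + k.+1 <= n)%N -> wedge c w (intv n i k.+1) = g i.
  by have [c hc] := H n; exists c => i ik; apply: hc => //; lia.
elim: m => [|m [c hc]]; first by exists (fun=> 0).
have [mk|mk] := ltnP (m + k) n; last first.
  exists c => i; rewrite ltnS leq_eqVlt => /orP[/eqP-> h|]; [lia | exact: hc].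
pose x := Ordinal mk; pose A := intv n m k.+1.
have Ax : A :\ x = intv n m k.
  by apply/setP => z; rewrite !inE -val_eqE /=; lia.
have xA : x \in A by rewrite inE /=; lia.
pose rest := \sum_(a in A | a != x) (-1) ^+ lo a A * c a * w (A :\ a).
exists (fun a => if a == x then (-1) ^+ lo x A * (g m - rest) / w (intv n m k)
                 else c a) => i.
rewrite ltnS leq_eqVlt => /orP[/eqP-> _|im ik]; last first.
  rewrite -(hc i im ik); apply: eq_wedge => // a; rewrite inE => ai.
  by case: eqP => // ax; move: ai; rewrite ax /=; lia.
rewrite /wedge (bigD1 x) //= eqxx -/A Ax.
rewrite [X in _ + X](_ : _ = rest); last first.
  by apply: eq_bigr => a /andP[_ /negbTE->].
rewrite -mulrA mulfVK ?w0 //; last lia.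
by rewrite mulrA -signr_addb addbb mul1r subrK.
Qed.

Lemma exists_minors (R : realType) (n : nat) (g : nat -> nat -> R) :
  (forall k i, g k i != 0) ->
  exists c : nat -> 'I_n -> R, forall k i, (0 < k)%N -> (i + k <= n)%N ->
    minor c k (intv n i k) = g k i.
Proof.
move=> g0; suff H K : exists c : nat -> 'I_n -> R, forall k i, (0 < k <= K)%N ->
    (i + k <= n)%N -> minor c k (intv n i k) = g k i.
  have [c hc] := H n; exists c => k i k0 ik; apply: hc => //; lia.
elim: K => [|K [c hc]]; first by exists (fun _ _ => 0) => k i; lia.
have [|d hd] := @solve_wedge R n K (minor c K) (g K.+1).
  case: K hc => [|K] hc i ik; last by rewrite hc // ltnS leqnn.
  have -> : intv n i 0 = set0 by apply/setP => x; rewrite !inE; lia.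
  by rewrite /= eqxx oner_neq0.
pose c' j := if j == K then d else c j.
have cc k : (k <= K)%N -> minor c' k =1 minor c k.
  by move=> kK; apply: minor_ext => j jk; rewrite /c' ltn_eqF // (leq_trans jk).
exists c' => k i /andP[k0]; rewrite leq_eqVlt => /orP[/eqP->|kK] ik.
  rewrite -(hd i ik) /= /c' eqxx; apply: eq_wedge => // B.
  exact: cc.
by move: kK; rewrite ltnS => kK; rewrite cc // hc // k0.
Qed.

(** Only the middle index differs in sign, so moving its term to the other side leaves an identity
    without subtraction. *)
Lemma par_triple (n : nat) (S : {set 'I_n}) (i j k : 'I_n) :
  i \notin S -> j \notin S -> k \notin S -> (i < j)%N -> (j < k)%N ->
  let J := i |: (j |: (k |: S)) in
  [/\ par i S J = odd #|S|, par j S J = ~~ odd #|S| & par k S J = odd #|S|].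
Proof.
move=> iS jS kS ij jk.
have lh x : x \notin S -> lo x S (+) hi x S = odd #|S|.
  by move=> xS; rewrite lo_hi (setDidPl _) // disjoint_sym disjoints1.
have jkS : j \notin k |: S by rewrite !inE negb_or jS -val_eqE /= neq_ltn jk.
have ijkS : i \notin j |: (k |: S).
  by rewrite !inE !negb_or iS -!val_eqE /= !neq_ltn ij (ltn_trans ij jk).
move: (lh i iS) (lh j jS) (lh k kS); rewrite /par !loU1 // !ltnn.
have -> : (j < i)%N = false by lia.
have -> : (k < i)%N = false by lia.
have -> : (k < j)%N = false by lia.
rewrite ij jk (ltn_trans ij jk).
by case: lo; case: lo; case: lo; case: hi; case: hi; case: hi; case: odd.
Qed.

Lemma triple_sets (n : nat) (S : {set 'I_n}) (i j k : 'I_n) :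
  i \notin S -> j \notin S -> k \notin S -> (i < j)%N -> (j < k)%N ->
  let J := i |: (j |: (k |: S)) in
  [/\ J :\ i = j |: (k |: S), J :\ j = i |: (k |: S), J :\ k = i |: (j |: S) &
   J :\: S = i |: [set j; k]].
Proof.
move=> iS jS kS ij jk J.
have ij' : i != j by rewrite -val_eqE /= neq_ltn ij.
have jk' : j != k by rewrite -val_eqE /= neq_ltn jk.
have ik' : i != k by rewrite -val_eqE /= neq_ltn (ltn_trans ij jk).
split; apply/setP => x; rewrite !inE.
- by case: (x =P i) => [->|_] //=; rewrite (negbTE ij') (negbTE ik') (negbTE iS).
- by case: (x =P j) => [->|_] //=; rewrite eq_sym (negbTE ij') (negbTE jk') (negbTE jS).
- by case: (x =P k) => [->|_] //=; rewrite eq_sym (negbTE ik') eq_sym (negbTE jk') (negbTE kS).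
- case: (x =P i) => [->|_]; first by rewrite iS.
  case: (x =P j) => [->|_]; first by rewrite jS.
  case: (x =P k) => [->|_]; first by rewrite kS.
  by rewrite /= andNb.
Qed.

Lemma minor_three_term (R : realType) (n : nat) (c : nat -> 'I_n -> R)
  (S : {set 'I_n}) (i j k : 'I_n) (P : {set 'I_n} -> R) :
  P =1 (fun A => minor c #|A| A) ->
  i \notin S -> j \notin S -> k \notin S -> (i < j)%N -> (j < k)%N ->
  P (j |: S) * P (i |: (k |: S)) =
  P (i |: S) * P (j |: (k |: S)) + P (k |: S) * P (i |: (j |: S)).
Proof.
move=> PE iS jS kS ij jk.
have ij' : i != j by rewrite -val_eqE /= neq_ltn ij.
have jk' : j != k by rewrite -val_eqE /= neq_ltn jk.
have ik' : i != k by rewrite -val_eqE /= neq_ltn (ltn_trans ij jk).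
have [Ji Jj Jk JS] := triple_sets iS jS kS ij jk.
have [pi pj pk] := par_triple iS jS kS ij jk.
have := minor_incidence c S (i |: (j |: (k |: S))) (leqnSn #|S|.+1).
have P1 x : x \notin S -> P (x |: S) = minor c #|S|.+1 (x |: S).
  by move=> xS; rewrite PE cardsU1 xS.
have P2 x z : x \notin S -> z \notin S -> x != z ->
    P (x |: (z |: S)) = minor c #|S|.+2 (x |: (z |: S)).
  by move=> xS zS xz; rewrite PE !cardsU1 !inE negb_or xz xS zS.
rewrite P1 // P1 // P1 // P2 // P2 // P2 // {P1 P2 PE}.
move: (minor c _) (minor c _) => m1 m2.
rewrite JS big_setU1 ?big_setU1 ?big_set1; last 2 first.
- by rewrite inE.
- by rewrite !inE negb_or ij'.
rewrite Ji Jj Jk pi pj pk signrN.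
by case: (odd #|S|); rewrite ?expr1 ?expr0 /=; lra.
Qed.

(** * Asymptotics *)

(** In other words [- ln x / lam] is h up to [C / lam]. C is a separate parameter so that it can be
    fixed before lam grows. *)
Definition asymp (R : realType) (lam C h x : R) : Prop :=
  expR (- (lam * h) - C) <= x /\ x <= expR (- (lam * h) + C).

Lemma asympM (R : realType) (lam C D h k x z : R) :
  asymp lam C h x -> asymp lam D k z -> asymp lam (C + D) (h + k) (x * z).
Proof.
move=> [x1 x2] [z1 z2].
have x0 : 0 <= x by apply: le_trans x1; apply: ltW; exact: exp.expR_gt0.
have z0 : 0 <= z by apply: le_trans z1; apply: ltW; exact: exp.expR_gt0.
have e0 (t : R) : 0 <= expR t by apply: ltW; exact: exp.expR_gt0.
split.
  rewrite (_ : _ - _ = (- (lam * h) - C) + (- (lam * k) - D)); last by ring.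
  by rewrite exp.expRD ler_pM.
rewrite (_ : _ + _ = (- (lam * h) + C) + (- (lam * k) + D)); last by ring.
by rewrite exp.expRD ler_pM.
Qed.

Lemma asymp_weaken (R : realType) (lam C D h x : R) :
  C <= D -> asymp lam C h x -> asymp lam D h x.
Proof.
move=> CD [h1 h2]; split; [apply: le_trans h1 | apply: le_trans h2 _];
  rewrite exp.ler_expR; lra.
Qed.

(** The sum is at least the summand with the smaller exponent and at most twice the upper bound of
    that summand; the extra 1 absorbs the factor 2, as [2 <= expR 1]. *)
Lemma asymp_min (R : realType) (lam C a b x z : R) : 0 <= lam ->
  asymp lam C a x -> asymp lam C b z ->
  asymp lam (C + 1) (Num.min a b) (x + z).
Proof.
wlog ab : a b x z / a <= b => [H l0 ax bz|l0 [x1 x2] [z1 z2]].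
  have /orP[ab|ba] := le_total a b; first exact: H ab l0 ax bz.
  by rewrite (addrC x) minC; exact: H ba l0 bz ax.
rewrite min_l //.
have z0 : 0 <= z by apply: le_trans z1; apply: ltW; exact: exp.expR_gt0.
have lab : lam * a <= lam * b by apply: ler_wpM2l.
split.
  apply: (@le_trans _ _ (expR (- (lam * a) - C))); last lra.
  by rewrite exp.ler_expR; lra.
apply: (@le_trans _ _ (expR (- (lam * a) + C) * 2)).
  suff : z <= expR (- (lam * a) + C) by lra.
  by apply: le_trans z2 _; rewrite exp.ler_expR; lra.
have -> : expR (- (lam * a) + (C + 1)) = expR (- (lam * a) + C) * expR 1.
  by rewrite -exp.expRD addrA.
rewrite ler_pM2l ?exp.expR_gt0 //.
by have := exp.expR_ge1Dx (1 : R); lra.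
Qed.

Lemma asympV (R : realType) (lam C D h k v z : R) :
  asymp lam C h v -> asymp lam D (h + k) (v * z) -> asymp lam (C + D) k z.
Proof.
move=> [v1 v2] [m1 m2].
have v0 : 0 < v by apply: lt_le_trans v1; exact: exp.expR_gt0.
have vz0 : 0 < v * z by apply: lt_le_trans m1; exact: exp.expR_gt0.
have z0 : 0 < z by move: vz0; rewrite pmulr_rgt0.
split.
  rewrite -(ler_pM2l (exp.expR_gt0 (- (lam * h) + C))) -exp.expRD.
  apply: le_trans (ler_wpM2r (ltW z0) v2); apply: le_trans m1.
  by rewrite exp.ler_expR; lra.
rewrite -(ler_pM2l (exp.expR_gt0 (- (lam * h) - C))) -exp.expRD.
apply: le_trans (ler_wpM2r (ltW z0) v1) _; apply: le_trans m2 _.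
by rewrite exp.ler_expR; lra.
Qed.

(** The positive tropicalization of [minor_three_term] for finite coordinates. *)
Definition three_term_min (R : realType) (n : nat) (h : {set 'I_n} -> R) :=
  forall (S : {set 'I_n}) (i j k : 'I_n),
  i \notin S -> j \notin S -> k \notin S -> (i < j)%N -> (j < k)%N ->
  h (j |: S) + h (i |: (k |: S)) =
  Num.min (h (i |: S) + h (j |: (k |: S))) (h (k |: S) + h (i |: (j |: S))).

(** One use of the three-term recursion costs twice the constant for products, 1 for the sum and the
    constant once more for the division. *)
Fixpoint asymp_const (R : realType) (w : nat) : R :=
  if w is w'.+1 then asymp_const R w' * 3 + 1 else 0.

Lemma asymp_const_ge0 (R : realType) (w : nat) : 0 <= asymp_const R w.
Proof. by elim: w => //= w; lra. Qed.

(** Induction on the length of an interval containing A. If A misses an end, the interval shrinks;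
    if A is the whole interval, its minor is prescribed. Otherwise A contains both ends i and k and
    misses some j between them, and the three-term relation yields its minor from five minors in
    shorter intervals. *)
Lemma minor_asymp (R : realType) (n : nat) (h : {set 'I_n} -> R) (lam : R)
  (c : nat -> 'I_n -> R) : 0 <= lam -> three_term_min h ->
  (forall k i, (0 < k)%N -> (i + k <= n)%N ->
     minor c k (intv n i k) = expR (- (lam * h (intv n i k)))) ->
  forall A : {set 'I_n}, A != set0 ->
    asymp lam (asymp_const R n) (h A) (minor c #|A| A).
Proof.
move=> l0 h3 hc; pose P (A : {set 'I_n}) := minor c #|A| A.
suff H w l (A : {set 'I_n}) : A != set0 -> A \subset intv n l w.+1 ->
    asymp lam (asymp_const R w) (h A) (P A).
  move=> A A0; apply: (asymp_weaken (C := asymp_const R n)) => //.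
  apply: (H n 0%N) => //.
  by apply/subsetP => x _; rewrite inE; have := ltn_ord x; lia.
have Pintv k i : (0 < k)%N -> (i + k <= n)%N ->
    asymp lam 0 (h (intv n i k)) (P (intv n i k)).
  move=> k0 ik; rewrite /P card_intv // hc //.
  by split; rewrite ?addr0 ?subr0.
elim: w l A => [|w IH] l A A0 Al.
  have [x xA] := set0Pn _ A0.
  have -> : A = intv n x 1.
    apply/setP => z; rewrite inE.
    have := subsetP Al x xA; rewrite inE => xl.
    apply/idP/idP => [zA|zx]; first by have := subsetP Al z zA; rewrite inE; lia.
    by have -> : z = x by apply/val_inj => /=; lia.
  by apply: Pintv => //; have := ltn_ord x; lia.
have C0 := asymp_const_ge0 R w.
have weak a x : asymp lam (asymp_const R w) a x -> asymp lam (asymp_const R w.+1) a x.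
  by apply: asymp_weaken => /=; lra.
have [/existsP[i /andP[iA /eqP il]]|noi] :=
  boolP [exists x, (x \in A) && (val x == l)]; last first.
  apply: weak; apply: (IH l.+1) => //; apply/subsetP => x xA.
  have := subsetP Al x xA; rewrite !inE => h'.
  have : val x != l.
    by apply: contraNneq noi => xl; apply/existsP; exists x; rewrite xA xl eqxx.
  by rewrite /=; lia.
have [/existsP[k /andP[kA /eqP kl]]|nok] :=
  boolP [exists x, (x \in A) && (val x == l + w.+1)%N]; last first.
  apply: weak; apply: (IH l) => //; apply/subsetP => x xA.
  have := subsetP Al x xA; rewrite !inE => h'.
  have : val x != (l + w.+1)%N.
    by apply: contraNneq nok => xl; apply/existsP; exists x; rewrite xA xl eqxx.
  by rewrite /=; lia.
have [e0|[j]] := set_0Vmem (intv n l w.+2 :\: A).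
  have -> : A = intv n l w.+2 by apply/eqP; rewrite eqEsubset Al -setD_eq0 e0 /=.
  apply: (asymp_weaken (C := 0)); first exact: asymp_const_ge0.
  by apply: Pintv => //; have := ltn_ord k; rewrite /= in kl *; lia.
rewrite !inE => /andP[jA jl]; rewrite /= in il kl.
have ji : (i < j)%N.
  by have : i != j by [apply: contraNneq jA => <-]; rewrite -val_eqE /=; lia.
have jk : (j < k)%N.
  by have : k != j by [apply: contraNneq jA => <-]; rewrite -val_eqE /=; lia.
pose S := A :\ i :\ k.
have iS : i \notin S by rewrite !inE eqxx andbF.
have kS : k \notin S by rewrite !inE eqxx.
have jS : j \notin S by rewrite !inE (negbTE jA) !andbF.
have ki : k != i by rewrite -val_eqE /= neq_ltn (ltn_trans ji jk) orbT.
have EA : A = i |: (k |: S) by rewrite /S setD1K ?setD1K // !inE ki.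
have SA x : x \in S -> [/\ (l <= x)%N, (x < l + w.+2)%N, x != l :> nat &
    x != (l + w.+1)%N :> nat].
  rewrite !inE -!val_eqE /= => /and3P[xk xi xA].
  have := subsetP Al x xA; rewrite inE => /andP[? ?].
  by split=> //; [rewrite -il | rewrite -kl].
have nz x (B : {set 'I_n}) : x |: B != set0 by apply/set0Pn; exists x; rewrite setU11.
have S1 (x : 'I_n) : (l < x)%N -> (x <= l + w.+1)%N -> x |: S \subset intv n l.+1 w.+1.
  move=> lx xl; apply/subsetP => z; rewrite in_setU1 [z \in intv _ _ _]inE.
  by case/orP => [/eqP->|/SA[]]; clear - lx xl; lia.
have iw : i |: S \subset intv n l w.+1.
  apply/subsetP => z; rewrite in_setU1 [z \in intv _ _ _]inE.
  by case/orP => [/eqP->|/SA[]]; clear - il; lia.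
have jkw : j |: (k |: S) \subset intv n l.+1 w.+1.
  apply/subsetP => z; rewrite 2!in_setU1 [z \in intv _ _ _]inE.
  by case/or3P => [/eqP->|/eqP->|/SA[]]; clear - ji jk il kl; lia.
have ijw : i |: (j |: S) \subset intv n l w.+1.
  apply/subsetP => z; rewrite 2!in_setU1 [z \in intv _ _ _]inE.
  by case/or3P => [/eqP->|/eqP->|/SA[]]; clear - ji jk il kl; lia.
have bj : asymp lam (asymp_const R w) (h (j |: S)) (P (j |: S)).
  by apply: IH (nz _ _) _; apply: S1; clear - ji jk il kl; lia.
have bi := IH l _ (nz _ _) iw.
have bk : asymp lam (asymp_const R w) (h (k |: S)) (P (k |: S)).
  by apply: IH (nz _ _) _; apply: S1; clear - ji jk il kl; lia.
have bjk := IH l.+1 _ (nz _ _) jkw.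
have bij := IH l _ (nz _ _) ijw.
have := asymp_min l0 (asympM bi bjk) (asympM bk bij).
rewrite -h3 // -(minor_three_term (c := c)) // -EA => /(asympV bj).
by apply: asymp_weaken => /=; lra.
Qed.

Lemma asymp1 (R : realType) (lam : R) : asymp lam 0 0 1.
Proof. by split; rewrite mulr0 ?oppr0 addr0 exp.expR0. Qed.

Lemma asympX (R : realType) (lam C h x : R) (k : nat) :
  asymp lam C h x -> asymp lam (k%:R * C) (k%:R * h) (x ^+ k).
Proof.
move=> xh; elim: k => [|k IH]; first by rewrite !mul0r expr0; exact: asymp1.
by rewrite -natr1 !mulrDl !mul1r exprSr; apply: asympM.
Qed.

Lemma asymp_prod (R : realType) (lam : R) (N : nat) (C h x : 'I_N -> R) :
  (forall i, asymp lam (C i) (h i) (x i)) ->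
  asymp lam (\sum_i C i) (\sum_i h i) (\prod_i x i).
Proof.
move=> hx; apply: (big_rec3 (fun C h x => asymp lam C h x)); first exact: asymp1.
by move=> i c d y _ H; exact: asympM.
Qed.

(** * Zeros at an exponential scale *)

Definition weight (R : realType) (N : nat) (h : 'I_N -> R) (b : 'X_{1..N}) : R :=
  \sum_(i < N) (b i)%:R * h i.

(** Otherwise, for a suitably large lam, the term of b0 outweighs all negative terms together and p
    cannot vanish. *)
Lemma vanishing_both_signs (R : realType) (N : nat) (p : {mpoly R[N]})
  (h : 'I_N -> R) (C : R) (b0 : 'X_{1..N}) : 0 <= C ->
  (forall lam, 0 <= lam -> exists v, (forall i, asymp lam C (h i) (v i)) /\
     p.@[v] = 0) ->
  b0 \in msupp p -> (forall b, b \in msupp p -> weight h b0 <= weight h b) ->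
  0 < p@_b0 -> exists b, [/\ b \in msupp p, p@_b < 0 & weight h b = weight h b0].
Proof.
move=> C0 van b0p b0min a0.
have [/hasP[b bp /andP[pb /eqP eb]]|/hasPn none] :=
  boolP (has (fun b => (p@_b < 0) && (weight h b == weight h b0)) (msupp p)).
  by exists b.
exfalso; set m := weight h b0 in b0min none *.
pose deg b := \sum_(i < N) (b i)%:R * C : R.
have deg0 (b : 'X_{1..N}) : 0 <= deg b by apply: sumr_ge0 => i _; rewrite mulr_ge0.
pose D := \sum_(b <- msupp p) deg b.
have degD b : b \in msupp p -> deg b <= D.
  move=> bp; rewrite /D (big_rem b) //= lerDl; exact: sumr_ge0.
pose S := \sum_(b <- msupp p) `|p@_b|.
(* One D pays for the lower bound of the term b0, the other for the upper bounds of non-minimal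
   terms. The remaining [S / p@_b0] beats their total coefficient S because [expR t >= 1 + t]. *)
pose E := 2 * D + S / p@_b0.
have D0 : 0 <= D by apply: sumr_ge0.
have S0 : 0 <= S by apply: sumr_ge0.
have E0 : 0 <= E by apply: addr_ge0; [rewrite mulr_ge0 | rewrite divr_ge0 // ltW].
(* A sum in place of a maximum; a minimal b contributes 0, since division by zero gives 0. *)
pose lam := \sum_(b <- msupp p) E / (weight h b - m).
have lam_ge b : b \in msupp p -> 0 <= E / (weight h b - m).
  by move=> bp; rewrite divr_ge0 // subr_ge0 b0min.
have lam0 : 0 <= lam by rewrite /lam big_seq sumr_ge0.
have lamE b : b \in msupp p -> m < weight h b -> E <= lam * (weight h b - m).
  move=> bp mb; rewrite -ler_pdivrMr ?subr_gt0 // /lam (big_rem b) //= lerDl.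
  by rewrite big_seq sumr_ge0 // => b' /mem_rem; exact: lam_ge.
have [v [hv pv]] := van lam lam0.
pose M (b : 'X_{1..N}) := \prod_i v i ^+ b i.
have MA b : b \in msupp p -> asymp lam D (weight h b) (M b).
  move=> bp; apply: asymp_weaken (degD b bp) _.
  by apply: asymp_prod => i; exact: asympX.
pose Y := expR (- (lam * m) - D); pose X := Y * expR (- (S / p@_b0)).
have Y0 : 0 < Y by exact: exp.expR_gt0.
have X0 : 0 <= X by apply: mulr_ge0; apply: ltW; exact: exp.expR_gt0.
have XE : X = expR (- (lam * m) - E + D).
  by rewrite /X /Y -exp.expRD; congr expR; rewrite /E; ring.
have bound b : b \in msupp p ->
    (if b == b0 then p@_b0 * Y else 0) - `|p@_b| * X <= p@_b * M b.
  move=> bp; have [M1 M2] := MA b bp.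
  have Mb0 : 0 <= M b by apply: le_trans M1; apply: ltW; exact: exp.expR_gt0.
  case: eqP => [bb|_].
    rewrite bb in M1 M2 Mb0 *.
    apply: (@le_trans _ _ (p@_b0 * Y)); first by rewrite gerBl mulr_ge0.
    by rewrite ler_pM2l.
  rewrite add0r; have [pb|pb] := leP 0 (p@_b).
    by apply: (@le_trans _ _ 0); rewrite ?oppr_le0 mulr_ge0.
  have mb : m < weight h b.
    rewrite lt_neqAle b0min // andbT eq_sym; have := none b bp.
    by rewrite pb.
  rewrite ltr0_norm // mulNr opprK ler_nM2l // XE.
  apply: le_trans M2 _; rewrite exp.ler_expR.
  have := lamE b bp mb; rewrite mulrBr; lra.
have : \sum_(b <- msupp p) ((if b == b0 then p@_b0 * Y else 0) - `|p@_b| * X) <= 0.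
  by rewrite -[leRHS]pv mevalE big_seq [leRHS]big_seq ler_sum.
rewrite sumrB (bigD1_seq b0) ?msupp_uniq //= eqxx big1 ?addr0 => [|b /negbTE-> //].
rewrite -mulr_suml -/S subr_le0 /X mulrCA mulrC ler_pM2l //.
rewrite -(ler_pM2r (exp.expR_gt0 (S / p@_b0))) -mulrA -exp.expRD addNr exp.expR0 mulr1.
move=> le1; have := exp.expR_ge1Dx (S / p@_b0).
rewrite -(ler_pM2l a0) mulrDr mulr1 mulrC divfK ?gt_eqF // => le2.
by have := le_trans le2 le1; rewrite gerDr leNgt a0.
Qed.

(** * Polynomials and points *)

Definition fOf (R : realType) (n : nat) (y : Point R n) (A : {set 'I_n}) : trop R :=
  if (insub A : option (Var n)) is Some v then y v else None.

Lemma fOf_val (R : realType) (n : nat) (y : Point R n) (v : Var n) :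
  fOf y (val v) = y v.
Proof. by rewrite /fOf valK. Qed.

Lemma fOf_valid (R : realType) (n : nat) (y : Point R n) (A : {set 'I_n}) :
  fOf y A != None -> validb A.
Proof. by rewrite /fOf; case: insubP. Qed.

Definition monS (n : nat) (A : {set 'I_n}) : 'X_{1..nvar n} :=
  if (insub A : option (Var n)) is Some v then U_(enum_rank v)%MM else 0%MM.

Lemma PvarE (R : realType) (n : nat) (A : {set 'I_n}) :
  validb A -> Pvar R A = 'X_[monS A].
Proof. by move=> vA; rewrite /Pvar /monS insubT. Qed.

Lemma IPsignE (R : realType) (n : nat) (j : 'I_n) (I J : {set 'I_n}) :
  IPsign R j I J = (-1) ^+ par j I J.
Proof. by rewrite /IPsign /par /lo /hi -oddD signr_odd. Qed.

Lemma term_valid (n : nat) (I J : {set 'I_n}) (j : 'I_n) :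
  (#|I| + 2 <= #|J|)%N -> j \in J :\: I -> validb (j |: I) && validb (J :\ j).
Proof.
rewrite inE => IJ /andP[jI jJ]; have := max_card (mem J); rewrite card_ord.
have cJ : #|J| = #|J :\ j|.+1 by rewrite (cardsD1 j) jJ.
rewrite /validb cardsU1 jI => Jn; move: Jn IJ; rewrite cJ => Jn.
move: Jn; rewrite addn2 !ltnS /= => Jn IJ.
by rewrite Jn (leq_ltn_trans _ Jn) // (leq_ltn_trans _ IJ).
Qed.

(** Kept as a sum because two indices can give the same monomial: if J is I with two more elements,
    the relation cancels to 0. *)
Lemma mcoeff_IPrel (R : realType) (n : nat) (I J : {set 'I_n})
  (b : 'X_{1..nvar n}) : (#|I| + 2 <= #|J|)%N ->
  (IPrel R I J)@_b = \sum_(j in J :\: I)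
     (-1) ^+ par j I J * ((monS (j |: I) + monS (J :\ j))%MM == b)%:R.
Proof.
move=> IJ; rewrite /IPrel raddf_sum /=; apply: eq_bigr => j jJI.
have /andP[v1 v2] := term_valid IJ jJI.
by rewrite mcoeffCM IPsignE !PvarE // -mpolyXD mcoeffX.
Qed.

Lemma tval_monS (R : realType) (n : nat) (y : Point R n) (A B : {set 'I_n}) :
  validb A -> validb B ->
  Defs.tval (monS A + monS B)%MM y = tadd (fOf y A) (fOf y B).
Proof.
move=> vA vB; rewrite /monS /fOf !insubT /Defs.tval.
set v := Sub A vA; set w := Sub B vB.
have sumE (u : Var n) : \sum_(i < nvar n) (enum_rank u == i)%:R *
    odflt 0 (y (enum_val i)) = odflt 0 (y u).
  rewrite (bigD1 (enum_rank u)) //= eqxx mul1r enum_rankK big1 ?addr0 // => i.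
  by rewrite eq_sym => /negbTE->; rewrite mul0r.
case: forallP => [H|H].
  have yN (u : Var n) : (u == v) || (u == w) -> y u != None.
    move=> uvw; have := H (enum_rank u); rewrite mnmDE !mnm1E enum_rankK.
    rewrite !(inj_eq enum_rank_inj) !(eq_sym _ u).
    by case/orP: uvw => /eqP->; rewrite eqxx ?addn1 ?add1n.
  have := yN v; have := yN w; rewrite !eqxx orbT => /(_ isT) + /(_ isT).
  case vE: (y v) => [c|] // ; case wE: (y w) => [d|] // _ _; congr Some.
  under eq_bigr => i _ do rewrite mnmDE !mnm1E natrD mulrDl.
  by rewrite big_split /= !sumE vE wE.
case vE: (y v) => [c|] //; case wE: (y w) => [d|] //; case: H => i.
apply/implyP; rewrite mnmDE !mnm1E.
case: eqP => [<- _|_]; first by rewrite enum_rankK vE.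
by case: eqP => [<- _|//]; rewrite enum_rankK wE.
Qed.

(** If the term j had no partner, all terms of at most its value would carry its sign. They could
    not cancel, and no minimal monomial would have the other sign. *)
Lemma pos_sol_IPok (R : realType) (n : nat) (y : Point R n)
  (I J : {set 'I_n}) : (#|I| + 2 <= #|J|)%N ->
  pos_sol (IPrel R I J) y -> IPok (fOf y) I J.
Proof.
move=> IJ sol j jJI jN; pose mon i := (monS (i |: I) + monS (J :\ i))%MM.
have monT i : i \in J :\: I -> Defs.tval (mon i) y = IPterm (fOf y) I J i.
  by move=> /(term_valid IJ)/andP[? ?]; exact: tval_monS.
have [/existsP[j' /and3P[? ? ?]]|none] := boolP [exists j', [&& j' \in J :\: I,
    par j' I J != par j I J & tle (IPterm (fOf y) I J j') (IPterm (fOf y) I J j)]].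
  by exists j'.
have sgn b : (forall i, i \in J :\: I -> mon i = b -> par i I J = par j I J) ->
    0 <= (-1) ^+ par j I J * (IPrel R I J)@_b.
  move=> same; rewrite mcoeff_IPrel // mulr_sumr; apply: sumr_ge0 => i iJI.
  case: eqP => [/(same i iJI) ->|_]; last by rewrite !mulr0.
  by rewrite mulr1 -signr_addb addbb.
have same i : i \in J :\: I -> tle (Defs.tval (mon i) y) (Defs.tval (mon j) y) ->
    par i I J = par j I J.
  move=> iJI le; apply/eqP/negPn/negP => ne; case/existsP: none; exists i.
  by rewrite iJI ne -!monT.
have jsupp : (IPrel R I J)@_(mon j) != 0.
  have : 0 < (-1) ^+ par j I J * (IPrel R I J)@_(mon j).
    rewrite mcoeff_IPrel // mulr_sumr (bigD1 j) //= eqxx mulr1 -signr_addb addbb.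
    apply: ltr_wpDr => //; apply: sumr_ge0 => i /andP[iJI _].
    case: eqP => [e|_]; last by rewrite !mulr0.
    by rewrite (same i iJI) ?mulr1 -?signr_addb ?addbb // /mon e tle_refl.
  by apply: contraTneq => ->; rewrite mulr0 ltxx.
case: sol => [p0|[b1 [b2 [[b1p b2p c1 c2] [tE tmin]]]]].
  by rewrite p0 mcoeff0 eqxx in jsupp.
have jin : mon j \in msupp (IPrel R I J) by rewrite mcoeff_msupp.
have tj := tmin _ jin.
exfalso; case pj: (par j I J) sgn => sgn.
  have : 0 <= (-1) ^+ true * (IPrel R I J)@_b1.
    by apply: sgn => i iJI e; rewrite -pj; apply: same; rewrite ?e.
  by rewrite expr1 mulN1r oppr_ge0 leNgt c1.
have : 0 <= (-1) ^+ false * (IPrel R I J)@_b2.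
  by apply: sgn => i iJI e; rewrite -pj; apply: same; rewrite ?e -?tE.
by rewrite expr0 mul1r leNgt c2.
Qed.

Lemma seq_argmin (R : realType) (T : eqType) (s : seq T) (g : T -> trop R) :
  s != [::] -> exists2 x, x \in s & forall z, z \in s -> tle (g x) (g z).
Proof.
elim: s => // a [|b s] IH _.
  by exists a; rewrite ?inE // => z; rewrite inE => /eqP->; exact: tle_refl.
have [x xs xmin] := IH isT; have [le|le] := orP (tle_total (g a) (g x)).
  exists a; rewrite ?mem_head // => z; rewrite inE => /orP[/eqP->|/xmin h].
    exact: tle_refl.
  exact: tle_trans h.
exists x; first by rewrite inE xs orbT.
by move=> z; rewrite inE => /orP[/eqP->|/xmin].
Qed.

Lemma tval_weight (R : realType) (n : nat) (y : Point R n) (b : 'X_{1..nvar n}) :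
  (forall v, y v != None) ->
  Defs.tval b y = Some (weight (fun i => odflt 0 (y (enum_val i))) b).
Proof.
move=> yN; rewrite /Defs.tval; case: forallP => // -[] i.
by rewrite yN implybT.
Qed.

Lemma vanishing_pos_sol (R : realType) (n : nat) (y : Point R n) (p : {mpoly R[nvar n]})
  (C : R) : 0 <= C -> (forall v, y v != None) ->
  (forall lam, 0 <= lam -> exists v : 'I_(nvar n) -> R,
     (forall i, asymp lam C (odflt 0 (y (enum_val i))) (v i)) /\ p.@[v] = 0) ->
  pos_sol p y.
Proof.
move=> C0 yN van; have [p0|p0] := eqVneq p 0; [by left | right].
pose h (i : 'I_(nvar n)) := odflt 0 (y (enum_val i)).
have [|b0 b0p b0min] := @seq_argmin R _ (msupp p) (fun b => Defs.tval b y).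
  by rewrite msupp_eq0.
have b0min' b : b \in msupp p -> weight h b0 <= weight h b.
  by move=> bp; have := b0min b bp; rewrite !tval_weight.
have := b0p; rewrite mcoeff_msupp neq_lt => /orP[neg|pos]; last first.
  have [b [bp bneg bE]] := vanishing_both_signs C0 van b0p b0min' pos.
  exists b0, b; split => //; split; last exact: b0min.
  by rewrite !tval_weight // bE.
have vanN lam : 0 <= lam -> exists v : 'I_(nvar n) -> R,
    (forall i, asymp lam C (h i) (v i)) /\ (- p).@[v] = 0.
  by move=> /van[v [hv pv]]; exists v; rewrite mevalN pv oppr0.
have inN b : (b \in msupp (- p)) = (b \in msupp p) by rewrite (perm_mem (msuppN p)).
have [|b|| b [+ + bE]] := vanishing_both_signs (b0 := b0) C0 vanN _ _ _.
- by rewrite inN.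
- by rewrite inN; exact: b0min'.
- by rewrite mcoeffN oppr_gt0.
rewrite inN mcoeffN oppr_lt0 => bp bpos.
exists b, b0; split => //; split => [|b' b'p]; rewrite !tval_weight // bE //.
exact: b0min'.
Qed.

Lemma meval_IPrel (R : realType) (n : nat) (c : nat -> 'I_n -> R)
  (v : 'I_(nvar n) -> R) (I J : {set 'I_n}) :
  (forall i, v i = minor c #|val (enum_val i)| (val (enum_val i))) ->
  (#|I| + 2 <= #|J|)%N -> (IPrel R I J).@[v] = 0.
Proof.
move=> vE IJ.
have PE A : validb A -> (Pvar R A).@[v] = minor c #|A| A.
  by move=> vA; rewrite /Pvar insubT mevalXU vE enum_rankK.
have le : (#|I|.+1 <= #|J|.-1)%N by move: IJ; rewrite addn2; case: #|J|.
rewrite -(minor_incidence c I J le) /IPrel raddf_sum /=; apply: eq_bigr => j jJI.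
have /andP[v1 v2] := term_valid IJ jJI.
rewrite mevalM mevalC IPsignE mevalM !PE //.
move: jJI; rewrite inE => /andP[jI jJ].
by rewrite cardsU1 jI (cardsD1 j J) jJ.
Qed.

Lemma I_IP_meval (R : realType) (n : nat) (c : nat -> 'I_n -> R)
  (v : 'I_(nvar n) -> R) (p : {mpoly R[nvar n]}) :
  (forall i, v i = minor c #|val (enum_val i)| (val (enum_val i))) ->
  I_IP p -> p.@[v] = 0.
Proof.
move=> vE [s [sP ->]]; rewrite raddf_sum /= big_seq big1 // => x xs.
have [I [J [[r [t [r0 rt tn cI cJ]]] ->]]] := sP x xs.
by rewrite mevalM (meval_IPrel vE) ?mulr0 // cI cJ addn2 ltnS prednK.
Qed.

(** * Passing to points with infinite coordinates *)

Lemma tval_eq_on_support (R : realType) (n : nat) (y y' : Point R n)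
  (b : 'X_{1..nvar n}) : (forall v, y v != None -> y' v = y v) ->
  Defs.tval b y != None -> Defs.tval b y' = Defs.tval b y.
Proof.
move=> yy'; rewrite /Defs.tval; case: forallP => // H _.
have E i : (0 < b i)%N -> y' (enum_val i) = y (enum_val i).
  by move=> bi; apply: yy'; apply: (implyP (H i)).
case: forallP => [_|[] i]; last first.
  by apply/implyP => bi; rewrite E //; apply: (implyP (H i)).
congr Some; apply: eq_bigr => i _.
by case bi: (b i) => [|k]; [rewrite !mul0r | rewrite E // bi].
Qed.

Lemma tval_off_support (R : realType) (n : nat) (y y' : Point R n)
  (b : 'X_{1..nvar n}) (K : R) : 0 <= K ->
  (forall v, y v != None -> y' v = y v) ->
  (forall v, y v = None -> tle (Some K) (y' v)) ->
  Defs.tval b y = None ->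
  tle (Some (K - weight (fun i => `|odflt 0 (y (enum_val i))|) b))
    (Defs.tval b y').
Proof.
move=> K0 yy' yK; rewrite /Defs.tval; case: forallP => // H _.
have [i0 bi0 yi0] : exists2 i, (0 < b i)%N & y (enum_val i) = None.
  have [/existsP[i]|nex] := boolP [exists i, (0 < b i)%N && (y (enum_val i) == None)].
    by case/andP => ? /eqP; exists i.
  case: H => i; apply/implyP => bi; apply: contra nex => /eqP yi.
  by apply/existsP; exists i; rewrite bi yi.
case: forallP => //= H'.
have yi0' : exists2 x, y' (enum_val i0) = Some x & K <= x.
  have := implyP (H' i0) bi0; have := yK _ yi0.
  by case: (y' _) => // x Kx _; exists x.
have [x xE Kx] := yi0'.
have bound i : (b i)%:R * - `|odflt 0 (y (enum_val i))| <=
    (b i)%:R * odflt 0 (y' (enum_val i)).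
  apply: ler_wpM2l => //; case yi: (y (enum_val i)) => [z|] /=.
    by rewrite yy' ?yi //= lerNnormlW.
  have := yK _ yi; case: (y' _) => [z|] /=; rewrite normr0 oppr0 // => Kz.
  exact: le_trans Kz.
rewrite /weight -sumrN (bigD1 i0) //= [leRHS](bigD1 i0) //= yi0 xE /=.
rewrite normr0 mulr0 oppr0 add0r; apply: lerD.
  rewrite -[leLHS]mul1r; apply: ler_pM => //; first by rewrite ler1n.
by apply: ler_sum => i _; rewrite -mulrN.
Qed.

Lemma pos_sol_approx (R : realType) (n : nat) (y : Point R n)
  (p : {mpoly R[nvar n]}) :
  (forall K : R, 0 <= K -> exists y', [/\ pos_sol p y',
     forall v, y v != None -> y' v = y v &
     forall v, y v = None -> tle (Some K) (y' v)]) -> pos_sol p y.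
Proof.
move=> approx; have [p0|p0] := eqVneq p 0; [by left | right].
have [|b0 b0p b0min] := @seq_argmin R _ (msupp p) (fun b => Defs.tval b y).
  by rewrite msupp_eq0.
pose L (b : 'X_{1..nvar n}) : R := weight (fun i => `|odflt 0 (y (enum_val i))|) b.
have L0 b : 0 <= L b by apply: sumr_ge0 => i _; rewrite mulr_ge0.
pose m : R := odflt 0 (Defs.tval b0 y).
(* If m is the finite minimum at y, each monomial infinite at y has value above m at [y']; so the
   minimal monomials at [y'] are finite at y and keep their values. *)
pose K := `|m| + 1 + \sum_(b <- msupp p) L b.
have K0 : 0 <= K by rewrite addr_ge0 ?addr_ge0 // sumr_ge0.
have [y' [sol yy' yK]] := approx K K0.
case: sol => [/eqP|[b1 [b2 [[b1p b2p c1 c2] [tE tmin]]]]]; first by rewrite (negbTE p0).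
exists b1, b2; split=> //.
case m0: (Defs.tval b0 y) => [m'|]; last first.
  (* All terms are infinite at y and tie, so only the signs of b1 and b2 matter. *)
  have allN b : b \in msupp p -> Defs.tval b y = None.
    by move=> /b0min; rewrite m0; case: Defs.tval.
  by rewrite !allN //; split => // b /allN ->.
have mE : m = m' by rewrite /m m0.
have fin b : b \in msupp p -> tle (Defs.tval b y') (Some m') -> Defs.tval b y != None.
  move=> bp le; apply/eqP => bN.
  have := tle_trans (tval_off_support K0 yy' yK bN) le.
  rewrite -/(L b) /= => h; have : L b <= \sum_(b <- msupp p) L b.
    by rewrite (big_rem b) //= lerDl sumr_ge0.
  by move: h; rewrite /K mE; have := ler_norm m'; lra.
have m'E : Defs.tval b0 y' = Some m'.
  by rewrite -m0; apply: tval_eq_on_support => //; rewrite m0.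
have le1 := tmin _ b0p; rewrite m'E in le1.
have f1 := fin _ b1p le1.
have f2 : Defs.tval b2 y != None by apply: fin => //; rewrite -tE.
rewrite -(tval_eq_on_support yy' f1) -(tval_eq_on_support yy' f2).
split=> // b bp; apply: tle_trans le1 _; rewrite -m0; exact: b0min.
Qed.

(** Only the middle index has the other sign: it is the partner of both outer terms, and one of them
    is its partner. *)
Lemma IPok_three_term_min (R : realType) (n : nat) (f : {set 'I_n} -> trop R)
  (H : {set 'I_n} -> R) :
  (forall A, validb A -> f A = Some (H A)) ->
  (forall I J : {set 'I_n}, (#|I| + 2 <= #|J|)%N -> IPok f I J) ->
  three_term_min H.
Proof.
move=> fH ok S i j k iS jS kS ij jk.
have [Ji Jj Jk JS] := triple_sets iS jS kS ij jk.
have [pi pj pk] := par_triple iS jS kS ij jk.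
set J := i |: _ in Ji Jj Jk JS pi pj pk.
have IJ : (#|S| + 2 <= #|J|)%N.
  rewrite /J !cardsU1 !inE !negb_or iS jS kS -!val_eqE /= !neq_ltn ij jk.
  by rewrite (ltn_trans ij jk) addn2.
have T x : x \in J :\: S -> IPterm f S J x = Some (H (x |: S) + H (J :\ x)).
  by move=> /(term_valid IJ)/andP[v1 v2]; rewrite /IPterm !fH.
have iJ : i \in J :\: S by rewrite JS !inE eqxx.
have jJ : j \in J :\: S by rewrite JS !inE eqxx orbT.
have kJ : k \in J :\: S by rewrite JS !inE eqxx !orbT.
have TN x : x \in J :\: S -> IPterm f S J x != None by move=> /T->.
have [x [xJ px lex]] := ok S J IJ i iJ (TN i iJ).
have [z [zJ pz lez]] := ok S J IJ k kJ (TN k kJ).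
have [w [wJ pw lew]] := ok S J IJ j jJ (TN j jJ).
have xj : x = j.
  by move: xJ px; rewrite JS !inE => /or3P[]/eqP-> //; rewrite ?pi ?pk eqxx.
have zj : z = j.
  by move: zJ pz; rewrite JS !inE => /or3P[]/eqP-> //; rewrite ?pi ?pk eqxx.
move: lex lez lew; rewrite xj zj !T // Ji Jj Jk /= => lei lek lew.
apply/eqP; rewrite eq_le le_min lei lek /= ge_min.
move: wJ pw lew; rewrite JS !inE => /or3P[]/eqP->; rewrite ?Ji ?Jk ?eqxx // => _ ->.
- by [].
- by rewrite orbT.
Qed.

Lemma finite_pos_sol (R : realType) (n : nat) (y : Point R n)
  (p : {mpoly R[nvar n]}) : (forall v, y v != None) ->
  (forall I J : {set 'I_n}, (#|I| + 2 <= #|J|)%N -> IPok (fOf y) I J) ->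
  I_IP p -> pos_sol p y.
Proof.
move=> yN ok pI; pose H A := odflt 0 (fOf y A).
have fH A : validb A -> fOf y A = Some (H A).
  move=> vA; rewrite /H /fOf insubT; set v := Sub A vA.
  by have := yN v; case: (y v).
have H3 := IPok_three_term_min fH ok.
apply: (vanishing_pos_sol (asymp_const_ge0 R n) yN) => lam l0.
pose g k i : R := expR (- (lam * H (intv n i k))).
have [k i|c hc] := @exists_minors R n g; first by rewrite gt_eqF ?exp.expR_gt0.
pose v (i : 'I_(nvar n)) : R := minor c #|val (enum_val i)| (val (enum_val i)).
exists v; split; last exact: I_IP_meval pI.
move=> i; have := minor_asymp l0 H3 hc (A := val (enum_val i)).
rewrite /H fOf_val; apply; rewrite -card_gt0.
by have /andP[] := valP (enum_val i).
Qed.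

Definition step_point (R : realType) (n : nat) (a b : 'I_n) (K : R)
  (y : Point R n) : Point R n := fun v => step a b K (fOf y) (val v).

Lemma fOf_step (R : realType) (n : nat) (a b : 'I_n) (K : R) (y : Point R n) :
  fOf (step_point a b K y) =1 step a b K (fOf y).
Proof.
have None_out B : ~~ validb B -> fOf y B = None by rewrite /fOf; case: insubP => // ? ->.
move=> A; rewrite {1}/fOf; case: insubP => [v _ <- //|vA].
rewrite /step; case: ifP => [/andP[bA aA]|_]; last by rewrite None_out.
by rewrite !None_out // /validb card_swp.
Qed.

Lemma eq_IPok (R : realType) (n : nat) (f g : {set 'I_n} -> trop R)
  (I J : {set 'I_n}) : f =1 g -> IPok f I J -> IPok g I J.
Proof.
move=> fg ok j jJI; have E x : IPterm g I J x = IPterm f I J x.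
  by rewrite /IPterm !fg.
rewrite E => jN; have [j' [? ? ?]] := ok j jJI jN.
by exists j'; rewrite E.
Qed.

Lemma towards (n : nat) (x z : 'I_n) : x != z ->
  exists x' : 'I_n, (x.+1 == x') || (x'.+1 == x) /\
    ((x' - z) + (z - x') < (x - z) + (z - x))%N.
Proof.
rewrite -val_eqE neq_ltn /= => /orP[xz|zx].
  have h : (x.+1 < n)%N by apply: leq_ltn_trans (ltn_ord z).
  by exists (Ordinal h); rewrite /= eqxx; split => //; clear h; lia.
have h : (x.-1 < n)%N by have := ltn_ord x; lia.
by exists (Ordinal h); split; rewrite /=; clear h; lia.
Qed.

(** Induction on the distance, through the neighbour [x'] of x towards z. If [x'] is in B, it goes
    to z first and x then takes its place; otherwise x goes to [x'] first. *)
Lemma adjacent_swaps_single (n : nat) (Q : pred {set 'I_n}) :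
  (forall (B : {set 'I_n}) (a b : 'I_n), (a.+1 == b) || (b.+1 == a) ->
     a \in B -> b \notin B -> Q B -> Q (b |: (B :\ a))) ->
  forall (B : {set 'I_n}) (x z : 'I_n), x \in B -> z \notin B -> Q B ->
    Q (z |: (B :\ x)).
Proof.
move=> Qadj B x z; have [m] := ubnP ((x - z) + (z - x))%N.
elim: m B x z => // m IH B x z hm xB zB QB.
have xz : x != z by apply: contraNneq zB => <-.
have [x' [adj dx']] := towards xz.
have x'x : x' != x by rewrite -val_eqE /=; clear - adj; lia.
have [x'z|x'z] := eqVneq x' z; first by apply: Qadj => //; rewrite -x'z.
have dlt : ((x' - z) + (z - x') < m)%N by apply: leq_trans dx' _.
have [x'B|x'B] := boolP (x' \in B).
  have := IH B x' z dlt x'B zB QB => QC.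
  have := Qadj _ x x' adj _ _ QC; rewrite !inE xB (eq_sym x x') x'x orbT eqxx.
  rewrite (negbTE x'z) /= => /(_ isT isT).
  congr (Q _); apply/setP => k; rewrite !inE.
  case: (k =P x') => [->|_] /=; first by rewrite x'B x'x orbT.
  by case: (k =P x) => [->|_] //=; rewrite (negbTE xz).
have QC := Qadj B x x' adj xB x'B QB.
have := IH _ x' z dlt _ _ QC; rewrite !inE eqxx /= negb_or (eq_sym z x') x'z.
rewrite (negbTE zB) andbF => /(_ isT isT).
congr (Q _); apply/setP => k; rewrite !inE.
by case: (k =P x') => [->|_] //=; rewrite (negbTE x'B) andbF.
Qed.

Lemma adjacent_swaps (n : nat) (Q : pred {set 'I_n}) :
  (forall (B : {set 'I_n}) (a b : 'I_n), (a.+1 == b) || (b.+1 == a) ->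
     a \in B -> b \notin B -> Q B -> Q (b |: (B :\ a))) ->
  forall A B : {set 'I_n}, #|A| = #|B| -> Q B -> Q A.
Proof.
move=> Qadj A B; have Qs := adjacent_swaps_single Qadj.
have [m] := ubnP #|B :\: A|; elim: m B => // m IH B hm AB QB.
have [e0|[x]] := set_0Vmem (B :\: A).
  suff -> : A = B by [].
  by apply/eqP; rewrite eq_sym eqEcard AB leqnn andbT -setD_eq0 e0.
move=> xBA; move: (xBA); rewrite inE => /andP[xA xB].
have : (0 < #|A :\: B|)%N.
  rewrite lt0n; apply: contraTneq xBA => A0.
  have /eqP : #|B :\: A| = 0%N.
    apply: (@addnI #|B :&: A|).
    by rewrite cardsID addn0 -AB -(cardsID B A) A0 addn0 setIC.
  by rewrite cards_eq0 => /eqP->; rewrite inE.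
case/card_gt0P => z; rewrite inE => /andP[zB zA].
apply: (IH (z |: (B :\ x))).
- rewrite -ltnS; apply: leq_trans hm; rewrite ltnS; apply: proper_card.
  apply/properP; split.
    apply/subsetP => k; rewrite !inE => /andP[kA /orP[/eqP kz|/andP[_ ->]]].
      by rewrite kz zA in kA.
    by rewrite kA.
  exists x => //; rewrite !inE eqxx /= orbF (negbTE xA) /=.
  by apply: contraNneq xA => ->.
- by rewrite AB cardsU1 !inE (negbTE zB) andbF (cardsD1 x B) xB.
- exact: Qs.
Qed.

(** Induction on the number of infinite coordinates. If there is one, some infinite coordinate is an
    adjacent swap away from a finite one: otherwise finiteness would spread through its size, where
    [in_TP] supplies a finite coordinate. The step at that swap makes it finite. *)
Lemma IPok_pos_sol (R : realType) (n : nat) (y : Point R n)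
  (p : {mpoly R[nvar n]}) : in_TP y ->
  (forall I J : {set 'I_n}, (#|I| + 2 <= #|J|)%N -> IPok (fOf y) I J) ->
  I_IP p -> pos_sol p y.
Proof.
have [m] := ubnP #|[set v : Var n | y v == None]|.
elim: m y => // m IH y hm yTP ok pI.
have [/existsP[v0 /eqP v0N]|allN] := boolP [exists v, y v == None]; last first.
  apply: finite_pos_sol => // v; apply: contra allN => vN; apply/existsP; by exists v.
have [v1 [a [b [adj bA aA v1N fsA]]]] : exists (v : Var n) (a b : 'I_n),
    [/\ (a.+1 == b) || (b.+1 == a), b \in val v, a \notin val v, y v = None &
        fOf y (swp a b (val v)) != None].
  have [/existsP[v /existsP[a /existsP[b /and5P[? ? ? /eqP ? ?]]]]|none] := boolP
    [exists v : Var n, exists a : 'I_n, exists b : 'I_n, [&& (a.+1 == b) || (b.+1 == a),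
       b \in val v, a \notin val v, y v == None & fOf y (swp a b (val v)) != None]].
    by exists v, a, b.
  have Qadj (B : {set 'I_n}) (a b : 'I_n) : (a.+1 == b) || (b.+1 == a) ->
      a \in B -> b \notin B -> fOf y B != None -> fOf y (b |: (B :\ a)) != None.
    move=> adj aB bB fB; apply: contra none => /eqP fN.
    have nba : b != a by apply: contraNneq bB => ->.
    have vA : validb (b |: (B :\ a)).
      by have := fOf_valid fB; rewrite /validb -/(swp b a B) card_swp.
    apply/existsP; exists (Sub _ vA); apply/existsP; exists a; apply/existsP; exists b.
    rewrite SubK adj setU11 !inE eqxx eq_sym (negbTE nba) /=.
    have -> : swp a b (b |: (B :\ a)) = B.
      by rewrite /swp setU1K ?setD1K // !inE (negbTE bB) andbF.
    by rewrite fB andbT -fOf_val SubK fN.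
  have /andP[k0 kn] := valP v0.
  have [|v [vk vN]] := yTP #|val v0|; first by rewrite k0 -ltnS prednK // (leq_trans _ kn).
  have := adjacent_swaps (Q := fun B => fOf y B != None) Qadj (A := val v0) (B := val v).
  by rewrite !fOf_val v0N vk => /(_ erefl vN).
apply: pos_sol_approx => K K0.
pose M := \sum_(v : Var n) `|odflt 0 (y v)|.
have M1 v x : y v = Some x -> `|x| <= M.
  move=> vx; rewrite /M (bigD1 v) //= vx /= lerDl; exact: sumr_ge0.
(* All finite coordinates lie between [- M] and M, so [K' + z >= K + M] for each of them: this
   undercuts no finite coordinate and is at least K. *)
pose K' := K + M + M.
exists (step_point a b K' y).
have keep v : y v != None -> step_point a b K' y v = y v.
  rewrite /step_point /step -fOf_val; case vx: (fOf y (val v)) => [x|] // _.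
  case: ifP => // _; rewrite /tmin; case: ifP => //.
  case wz: (fOf y (swp a b (val v))) => [z|] //= /negbT; rewrite -ltNge => lt.
  exfalso; rewrite fOf_val in vx; have := M1 _ _ vx.
  move: wz; rewrite /fOf; case: insubP => // w _ _ /M1.
  rewrite !ler_norml => /andP[h1 h2] /andP[h3 h4]; move: lt; rewrite /K'.
  clear - h1 h2 h3 h4 K0; lra.
have raise v : y v = None -> tle (Some K) (step_point a b K' y v).
  rewrite /step_point /step -fOf_val => vN; rewrite vN; case: ifP => // _.
  rewrite /tmin; case wz: (fOf y (swp a b (val v))) => [z|] //=.
  move: wz; rewrite /fOf; case: insubP => // w _ _ /M1.
  rewrite !ler_norml => /andP[h1 h2]; have M0 : 0 <= M by apply: sumr_ge0.
  rewrite /K'; clear - h1 h2 M0; lra.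
split => //; apply: IH pI.
- rewrite -ltnS; apply: leq_trans hm; rewrite ltnS; apply: proper_card.
  apply/properP; split.
    apply/subsetP => v; rewrite !inE; apply: contraLR => vN.
    by rewrite keep.
  have fN : fOf y (val v1) = None by rewrite fOf_val.
  exists v1; rewrite inE ?v1N // /step_point /step bA aA fN.
  by rewrite /tmin; case: (fOf y (swp _ _ _)) fsA.
- move=> k /yTP[v [vk vN]]; exists v; split => //; by rewrite keep.
move=> I J IJ; apply: (eq_IPok (f := step a b K' (fOf y))).
  by move=> B; rewrite fOf_step.
exact: step_IPok.
Qed.

(** * Support flag matroids *)

Lemma suppP (R : realType) (n : nat) (y : Point R n) (X : {set 'I_n}) :
  Defs.supp y X <-> fOf y X != None.
Proof.
split=> [[v [<- ?]]|]; first by rewrite fOf_val.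
by rewrite /fOf; case: insubP => // v _ <- vN; exists v.
Qed.

(** In the relation [(B1 :\ x, x |: B2)] the term x is the product of the coordinates of B1 and B2,
    and the factors of its partner z are the exchanged sets. *)
Lemma IPok_exchange (R : realType) (n : nat) (f : {set 'I_n} -> trop R)
  (B1 B2 : {set 'I_n}) (x : 'I_n) :
  (forall I J : {set 'I_n}, (#|I| + 2 <= #|J|)%N -> IPok f I J) ->
  f B1 != None -> f B2 != None -> (#|B1| <= #|B2|)%N -> x \in B1 :\: B2 ->
  exists2 z, z \in B2 :\: B1 &
    (f (z |: (B1 :\ x)) != None) && (f (x |: (B2 :\ z)) != None).
Proof.
move=> ok f1 f2 c12; rewrite inE => /andP[xB2 xB1].
have IJ : (#|B1 :\ x| + 2 <= #|x |: B2|)%N.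
  by move: c12; rewrite (cardsD1 x B1) xB1 cardsU1 xB2 addn2 !add1n ltnS.
have xD : x \in (x |: B2) :\: (B1 :\ x) by rewrite !inE !eqxx.
have xT : IPterm f (B1 :\ x) (x |: B2) x != None.
  by rewrite /IPterm setD1K // setU1K // taddN f1.
have [z [zD pz /tleN/(_ xT)]] := ok _ _ IJ x xD xT.
have zx : z != x by apply: contraNneq pz => ->.
rewrite taddN => zT; exists z; move: zD; rewrite !inE (negbTE zx) //=.
suff <- : (x |: B2) :\ z = x |: (B2 :\ z) by [].
apply/setP => k; rewrite !inE; case: (k =P x) => [->|_] //=.
by rewrite eq_sym zx.
Qed.

(** Exchange moves Y towards X to give the superset, and X towards Y to give the subset; both moves
    shrink [X :\: Y]. *)
Lemma IPok_extend (R : realType) (n : nat) (f : {set 'I_n} -> trop R)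
  (X Y : {set 'I_n}) :
  (forall I J : {set 'I_n}, (#|I| + 2 <= #|J|)%N -> IPok f I J) ->
  f X != None -> f Y != None -> (#|X| <= #|Y|)%N ->
  (exists Z, [/\ f Z != None, #|Z| = #|Y| & X \subset Z]) /\
  (exists Z, [/\ f Z != None, #|Z| = #|X| & Z \subset Y]).
Proof.
move=> ok; have [m] := ubnP #|X :\: Y|; elim: m X Y => // m IH X Y hm fX fY XY.
have [e0|[x xD]] := set_0Vmem (X :\: Y).
  have XsubY : X \subset Y by rewrite -setD_eq0 e0.
  by split; [exists Y | exists X].
have [z zD /andP[fX' fY']] := IPok_exchange ok fX fY XY xD.
move: (xD) (zD); rewrite !inE => /andP[xY xX] /andP[zX zY].
have cX : #|z |: (X :\ x)| = #|X|.
  by rewrite cardsU1 !inE (negbTE zX) andbF (cardsD1 x X) xX.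
have cY : #|x |: (Y :\ z)| = #|Y|.
  by rewrite cardsU1 !inE (negbTE xY) andbF (cardsD1 z Y) zY.
have less (A B : {set 'I_n}) : A :\: B \subset (X :\: Y) :\ x -> (#|A :\: B| < m)%N.
  move=> AB; rewrite -ltnS; apply: leq_trans hm; rewrite ltnS (cardsD1 x (X :\: Y)) xD.
  by rewrite add1n ltnS; apply: subset_leq_card.
have ltX : (#|(z |: (X :\ x)) :\: Y| < m)%N.
  apply: less; apply/subsetP => k; rewrite !inE => /andP[kY /orP[/eqP kz|/andP[-> ->]]].
    by rewrite kz zY in kY.
  by rewrite kY.
have ltY : (#|X :\: (x |: (Y :\ z))| < m)%N.
  apply: less; apply/subsetP => k; rewrite !inE negb_or => /andP[/andP[-> h] kX].
  by rewrite kX andbT; apply: contra h => ->; rewrite andbT; apply: contraNneq zX => <-.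
have := IH _ _ ltX fX' fY; rewrite cX => /(_ XY)[_ downX].
by have := IH _ _ ltY fX fY'; rewrite cY => /(_ XY)[upY _].
Qed.

Lemma IPok_flag_matroid (R : realType) (n : nat) (y : Point R n) :
  in_TP y ->
  (forall I J : {set 'I_n}, (#|I| + 2 <= #|J|)%N -> IPok (fOf y) I J) ->
  supp_flag_matroid y.
Proof.
move=> yTP ok; pose M k := [set X : {set 'I_n} | (#|X| == k) && (fOf y X != None)].
have yM k : (1 <= k <= n.-1)%N -> exists X, X \in M k.
  by move=> /yTP[v [vk vN]]; exists (val v); rewrite inE vk eqxx fOf_val.
exists M; split; last first.
  move=> k _ X; rewrite inE; split; first by move=> /andP[/eqP ? /suppP ?].
  by move=> [/suppP -> ->]; rewrite eqxx.
split.
  move=> k kn; split; last by move=> X; rewrite inE => /andP[/eqP].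
  split; first by have [X XM] := yM k kn; apply/set0Pn; exists X.
  move=> B1 B2; rewrite !inE => /andP[/eqP c1 f1] /andP[/eqP c2 f2] x xD.
  have [|z zD /andP[fz _]] := IPok_exchange ok f1 f2 _ xD; first by rewrite c1 c2.
  exists z => //; rewrite inE fz andbT.
  move: xD zD; rewrite !inE => /andP[_ xB] /andP[zB _].
  by rewrite cardsU1 !inE (negbTE zB) andbF -c1 (cardsD1 x B1) xB.
move=> j k j1 jk kn; split=> [X|Y]; rewrite inE => /andP[/eqP c f].
  have [|Y] := yM k; first by rewrite kn (leq_trans j1) // ltnW.
  rewrite inE => /andP[/eqP cY fY].
  have [|[Z [fZ cZ XZ]] _] := IPok_extend ok f fY; first by rewrite c cY ltnW.
  by exists Z => //; rewrite inE cZ cY eqxx.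
have [|X] := yM j; first by rewrite j1 (leq_trans (ltnW jk)).
rewrite inE => /andP[/eqP cX fX].
have [|_ [Z [fZ cZ ZY]]] := IPok_extend ok fX f; first by rewrite c cX ltnW.
by exists Z => //; rewrite inE cZ cX eqxx.
Qed.

Lemma flag_matroid_IPok (R : realType) (n : nat) (y : Point R n) :
  supp_flag_matroid y ->
  (forall I J : {set 'I_n}, (#|I| + 2 <= #|J|)%N -> #|J :\: I| = 3%N ->
     IPok (fOf y) I J) ->
  forall I J : {set 'I_n}, (#|I| + 2 <= #|J|)%N -> IPok (fOf y) I J.
Proof.
move=> [M [[Mk Mjk] Msupp]] three.
have rank X : fOf y X != None -> (1 <= #|X| <= n.-1)%N.
  move=> /fOf_valid/andP[? h]; apply/andP; split=> //.
  by rewrite -ltnS prednK // (leq_trans _ h).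
have inM X : fOf y X != None -> X \in M #|X|.
  by move=> fX; apply/Msupp; [exact: rank | split=> //; apply/suppP].
have outM k X : (1 <= k <= n.-1)%N -> X \in M k -> fOf y X != None /\ #|X| = k.
  by move=> hk /(Msupp k hk)[/suppP].
apply: three_term_IPok => //.
- by move=> X /fOf_valid.
- move=> C D x fC fD cCD xD; have [[_ ex] _] := Mk _ (rank C fC).
  have DM : D \in M #|C| by rewrite cCD; exact: inM.
  have [z zD zM] := ex C D (inM C fC) DM x xD; exists z => //.
  by have [] := outM _ _ (rank C fC) zM.
- move=> X k fX; rewrite leq_eqVlt => /orP[/eqP<- _|Xk kn]; first by exists X.
  have /andP[X0 _] := rank X fX.
  have kn' : (k <= n.-1)%N by rewrite -ltnS prednK // (leq_ltn_trans _ kn).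
  have [up _] := Mjk _ _ X0 Xk kn'; have [Y YM XY] := up X (inM X fX).
  by exists Y; have [|fY cY] := outM k Y _ YM; first by rewrite kn' (leq_trans X0) // ltnW.
- move=> Y k fY /andP[k0]; rewrite leq_eqVlt => /orP[/eqP->|kY]; first by exists Y.
  have /andP[_ Yn] := rank Y fY.
  have [_ down] := Mjk _ _ k0 kY Yn; have [X XM XY] := down Y (inM Y fY).
  by exists X; have [|fX cX] := outM k X _ XM; first by rewrite k0 (leq_trans (ltnW kY)).
Qed.

Lemma IPadmP (n : nat) (I J : {set 'I_n}) :
  IPadm I J <-> (#|I| + 2 <= #|J|)%N.
Proof.
split=> [[r [s [r1 rs _ -> ->]]]|IJ]; first by rewrite addn2 ltnS prednK.
have := max_card (mem J); rewrite card_ord => Jn.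
exists #|I|.+1, #|J|.-1; move: IJ Jn; rewrite addn2; case: #|J| => // s IJ Jn.
by split=> //; exact: ltnW.
Qed.

Theorem theorem4 (R : realType) (n : nat) (hn : (2 <= n)%N)
  (y : Point R n) (hy : in_TP y) :
  (trFl_pos y <-> FlDr3M_pos y) /\ (FlDr3M_pos y <-> FlDr_pos y).
Proof.
have tr_Fl : trFl_pos y -> FlDr_pos y.
  move=> tr p pS; apply: tr; exists [:: (1, p)]; split.
    by move=> x; rewrite inE => /eqP->.
  by rewrite big_seq1 mul1r.
have Fl_M : FlDr_pos y -> FlDr3M_pos y.
  move=> Fl; split.
    by move=> p [I [J [IJ _ ->]]]; apply: Fl; exists I, J.
  apply: IPok_flag_matroid => // I J IJ; apply: pos_sol_IPok => //.
  by apply: Fl; exists I, J; split => //; apply/IPadmP.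
have M_tr : FlDr3M_pos y -> trFl_pos y.
  move=> [three flag] p; apply: IPok_pos_sol => //.
  apply: flag_matroid_IPok => // I J IJ J3; apply: pos_sol_IPok => //.
  by apply: three; exists I, J; split => //; apply/IPadmP.
by split; split; auto.
Qed.
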